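(* Let $0<\alpha<1$, $1<p<\infty$, $T>0$, $\mu>0$, and $\omega(t)=\left(\ln\frac{eT}{t}\right)^{-\mu}$ on $(0,T)$. Then there exists a constant $C>0$ such that for every $y\in W^{2,p}_\omega(0,T)$, every integer $N\ge1$ with $\tau=T/N$ and $t_n=n\tau$, and every $1\le n\le N$, $$|D^\alpha y(t_n)-\delta_\tau^\alpha y(t_n)|\le C\,\tau^{2-\alpha-1/p}\left(\ln\frac{eT}{\tau}\right)^{\frac{\mu}{p}}\|y\|_{W^{2,p}_\omega}.$$ In particular $C$ does not depend on $\tau$, $n$ or $y$.
   Context: For a weight (locally integrable function) $\omega:(0,T)\to[0,\infty)$, $L^p_\omega(0,T)$ has norm $\|y\|_{L^p_\omega}=\left(\int_0^T|y(t)|^p\omega(t)\,dt\right)^{1/p}$, and $W^{s,p}_\omega(0,T)=\{y\in L^p_\omega(0,T): y',\dots,y^{(s)}\in L^p_\omega(0,T)\}$ (weak derivatives) with norm $\|y\|_{W^{s,p}_\omega}=\left(\int_0^T\left(\sum_{k=0}^s|y^{(k)}(t)|^p\right)\omega(t)\,dt\right)^{1/p}$. Functions $y\in W^{2,p}_\omega(0,T)$ are identified with their continuously differentiable representatives on $[0,T]$ (with $y'$ absolutely continuous). Here $e$ is Euler's number. The Caputo derivative of order $\alpha\in(0,1)$ is $D^\alpha y(t)=\frac1{\Gamma(1-\alpha)}\int_0^t\frac{y'(s)}{(t-s)^\alpha}\,ds$. The L1 scheme on the grid $t_n=n\tau$, $n\ge1$, is $$\delta_\tau^\alpha y(t_n)=\frac{\tau^{-\alpha}}{\Gamma(2-\alpha)}\left(y(t_n)-b_{n-1}y(0)-\sum_{i=1}^{n-1}(b_{n-i-1}-b_{n-i})y(t_i)\right),\qquad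 b_i=(i+1)^{1-\alpha}-i^{1-\alpha}.$$ *)

(* Defs.v *)
From mathcomp Require Import all_boot all_order all_algebra.
From mathcomp Require Import all_classical all_reals all_analysis.
Set Implicit Arguments.
Unset Strict Implicit.
Unset Printing Implicit Defensive.
Import Order.TTheory GRing.Theory Num.Theory.
Import numFieldNormedType.Exports.
Local Open Scope classical_set_scope.
Local Open Scope ring_scope.

Section WeightedSobolev.
Context {R : realType}.
Let leb := @lebesgue_measure R.
Implicit Types (T p : R) (w phi f g y : R -> R) (k s : nat).

(* C_c^oo(0, T), each element being extended by zero to the whole line. *)
Definition test_function T phi : Prop :=
  (forall k x, derivable (derive1n k phi) x 1) /\
  exists K : set R, [/\ compact K, K `<=` `]0, T[ &
    forall x, ~ K x -> phi x = 0].

Definition is_weak_derivative T k f g : Prop :=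
  [/\ locally_integrable `]0, T[ f, locally_integrable `]0, T[ g &
    forall phi, test_function T phi ->
      \int[leb]_(t in `]0, T[) (f t * derive1n k phi t) =
      (-1) ^+ k * \int[leb]_(t in `]0, T[) (g t * phi t)].

(* For k > 0, an arbitrary representative of the weak derivative (which is
   unique up to equality almost everywhere), and 0 if there is none. *)
Definition weak_derivative T k y : R -> R :=
  if k is 0%N then y
  else xget (fun=> 0) [set g | is_weak_derivative T k y g].

Definition weighted_Lp T w p f : Prop :=
  measurable_fun `]0, T[ f /\
  (\int[leb]_(t in `]0%R, T[) (`|f t| `^ p * w t)%:E < +oo)%E.

Definition weighted_Sobolev T w s p y : Prop :=
  forall k, (k <= s)%N ->
    is_weak_derivative T k y (weak_derivative T k y) /\
    weighted_Lp T w p (weak_derivative T k y).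

Definition Sobolev_norm T w s p y : R :=
  (\int[leb]_(t in `]0, T[)
     ((\sum_(0 <= k < s.+1) `|weak_derivative T k y t| `^ p) * w t)) `^ p^-1.

(* y is C^1 on [0, T]: y is continuous on [0, T] and differentiable inside,
   and y' extends continuously to [0, T].  The absolute continuity of y' is
   not required here: it is automatic when y' has a weak derivative that is
   integrable on (0, T). *)
Definition C1_closed T y : Prop :=
  derivable_oo_LRcontinuous y 0 T /\
  exists2 dy : R -> R, {within `[0, T], continuous dy} &
    {in `]0, T[, derive1 y =1 dy}.

End WeightedSobolev.

Section Caputo.
Context {R : realType}.
Let leb := @lebesgue_measure R.
Implicit Types (alpha tau t x : R) (y : R -> R).

Definition Gamma x : R := \int[leb]_(t in `]0, +oo[) (t `^ (x - 1) * expR (- t)).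

Definition Caputo alpha y t : R :=
  (Gamma (1 - alpha))^-1 *
  \int[leb]_(s in `]0, t[) (derive1 y s / (t - s) `^ alpha).

Definition L1_coef alpha (i : nat) : R :=
  i.+1%:R `^ (1 - alpha) - i%:R `^ (1 - alpha).

(* The value at the grid point t_n = n tau, for n >= 1. *)
Definition L1_scheme alpha tau y (n : nat) : R :=
  tau `^ (- alpha) / Gamma (2 - alpha) *
  (y (n%:R * tau) - L1_coef alpha n.-1 * y 0
   - \sum_(1 <= i < n)
       (L1_coef alpha (n - i - 1) - L1_coef alpha (n - i)) * y (i%:R * tau)).

End Caputo.

Definition log_weight {R : realType} (T mu t : R) : R :=
  ln (expR 1 * T / t) `^ (- mu).

(* Main.v *)
(** Write [k s = (t_n - s)^(-alpha)].  Since [Gamma (2 - alpha) =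
    (1 - alpha) * Gamma (1 - alpha)], summation by parts turns the L1 scheme
    into the Caputo integral with [y'] replaced on each cell [(t_i, t_{i+1})]
    by its mean slope.  The difference [e] between [y'] and that slope has zero
    integral over the cell, so [k] may be replaced there by [k - k t_i], and the
    cell error is at most [M * (\int k - tau * k t_i)], where [M] bounds the
    oscillation of [y'] on a cell.  The sum over all cells telescopes and is at
    most [M * tau^(1 - alpha) / (1 - alpha)].

    The oscillation of [y'] on a cell is at most the integral of [|y''|] over
    it, as is seen by testing the weak second derivative against smooth
    approximations of the indicator of an interval.  By Hoelder's inequality
    this integral is bounded by the weighted norm times the [L^q] norm of
    [ln (e T / t)^(mu / p)] over the cell, which is
    [O(tau^(1 - 1/p) * ln (e T / tau)^(mu / p))] because
    [ln (e T / t) <= ln (e T / tau) * (1 + ln (tau / t))] for [t < tau]. *)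
Require Import Defs.
From mathcomp Require Import all_boot all_order all_algebra.
From mathcomp Require Import all_classical all_reals all_analysis.
From mathcomp Require Import measurable_realfun ring lra.
Import Order.TTheory GRing.Theory Num.Theory.
Import numFieldNormedType.Exports.
Local Open Scope classical_set_scope.
Local Open Scope ring_scope.
Set Implicit Arguments.
Unset Strict Implicit.
Unset Printing Implicit Defensive.

(** * A smooth step *)

Section SmoothStep.
Context {R : realType}.
Implicit Types (f g : R -> R) (x c d : R) (k n : nat).

(** Differentiability [k.+1] times, with the recursion on the derivative of [f] rather than on the
    outer iterate [derive1n], so that sum, product and quotient rules propagate by induction on
    [k]. *)
Fixpoint Cdiff k f : Prop :=
  (forall x, derivable f x 1) /\ (if k is k'.+1 then Cdiff k' (derive1 f) else True).

Lemma CdiffP f : (forall k, Cdiff k f) <-> (forall k x, derivable (derive1n k f) x 1).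
Proof.
split=> H k.
  move: (H k); elim: k f {H} => [|k IHk] f [df]; first by [].
  by move=> /IHk; rewrite derive1Sn.
elim: k f H => [|k IHk] f H /=; split => //.
- by move=> x; have := H 0%N x.
- by move=> x; have := H 0%N x.
- by apply: IHk => k' x; rewrite -derive1Sn; exact: H.
Qed.

Lemma Cdiff_derivable k f x : Cdiff k f -> derivable f x 1.
Proof. by case: k => [|k] []. Qed.

Lemma CdiffW k f : Cdiff k.+1 f -> Cdiff k f.
Proof.
elim: k f => [|k IHk] f [df df']; first by split.
by split => //; exact: IHk.
Qed.

Lemma is_derive_derive1 f f' : (forall x, is_derive x 1 f (f' x)) -> derive1 f = f'.
Proof. by move=> df; apply/funext => x; rewrite derive1E; case: (df x). Qed.

Lemma is_derive_CdiffS k f f' :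
  (forall x, is_derive x 1 f (f' x)) -> Cdiff k f' -> Cdiff k.+1 f.
Proof.
by move=> df cf'; split; [move=> x; case: (df x)|rewrite (is_derive_derive1 df)].
Qed.

Lemma Cdiff_is_derive k f x : Cdiff k f -> is_derive x 1 f (derive1 f x).
Proof. by rewrite derive1E => /(@Cdiff_derivable _ _ x) /derivableP. Qed.

Lemma Cdiff_cst k c : Cdiff k (cst c).
Proof.
elim: k c => [|k IHk] c; first by split=> // x; exact: derivable_cst.
by apply: (is_derive_CdiffS (f' := cst 0)).
Qed.

Lemma CdiffD k f g : Cdiff k f -> Cdiff k g -> Cdiff k (f \+ g).
Proof.
elim: k f g => [|k IHk] f g cf cg.
  by split=> // x; apply: derivableD; [exact: Cdiff_derivable cf|exact: Cdiff_derivable cg].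
apply: (is_derive_CdiffS (f' := (derive1 f) \+ (derive1 g))).
  by move=> x; apply: is_deriveD; [exact: Cdiff_is_derive cf|exact: Cdiff_is_derive cg].
by apply: IHk; [case: cf|case: cg].
Qed.

Lemma CdiffM k f g : Cdiff k f -> Cdiff k g -> Cdiff k (f \* g).
Proof.
elim: k f g => [|k IHk] f g cf cg.
  by split=> // x; apply: derivableM; [exact: Cdiff_derivable cf|exact: Cdiff_derivable cg].
apply: (is_derive_CdiffS (f' := (f \* (derive1 g)) \+ (g \* (derive1 f)))).
  by move=> x; apply: is_deriveM; [exact: Cdiff_is_derive cf|exact: Cdiff_is_derive cg].
by apply: CdiffD; apply: IHk; [exact: CdiffW| case: cg|exact: CdiffW| case: cf].
Qed.

Lemma CdiffB k f g : Cdiff k f -> Cdiff k g -> Cdiff k (f \- g).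
Proof.
move=> cf cg; rewrite (_ : f \- g = f \+ (cst (-1) \* g)).
  by apply: CdiffD => //; apply: CdiffM => //; exact: Cdiff_cst.
by apply/funext => x /=; rewrite mulN1r.
Qed.

(** The derivative of the reciprocal is a product of two copies of the reciprocal and of
    [derive1 f], so the induction hypothesis one order lower and [CdiffM] suffice. *)
Lemma CdiffV k f : (forall x, f x != 0) -> Cdiff k f -> Cdiff k (fun x => (f x)^-1).
Proof.
move=> f0; have dV j x : Cdiff j f -> is_derive x 1 (fun x => (f x)^-1)
    (- (f x)^-1 * (f x)^-1 * derive1 f x).
  move=> /(@Cdiff_is_derive _ _ x) df.
  have := is_deriveV (f0 x) df; by rewrite /GRing.scale /= expr2 invfM !mulNr.
elim: k => [|k IHk] cf; first by split => // x; case: (dV _ x cf).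
apply: is_derive_CdiffS => [x|]; first exact: dV cf.
have IHk' := IHk (CdiffW cf).
apply: (CdiffM (f := fun x => - (f x)^-1 * (f x)^-1)); last by case: cf.
apply: (CdiffM (f := fun x => - (f x)^-1)) => //.
have := CdiffB (Cdiff_cst k 0) IHk'.
by congr Cdiff; apply/funext => x /=; rewrite sub0r.
Qed.

Lemma is_derive_affine f c d x : derivable f (c * x + d) 1 ->
  is_derive x 1 (fun x => f (c * x + d)) (c * derive1 f (c * x + d)).
Proof.
move=> /derivableP df.
have da : is_derive x 1 (fun x => c * x + d) c.
  by apply: is_derive_eq; rewrite addr0; exact: mulr1.
have := @is_derive1_comp _ f (fun x => c * x + d) _ _ _ df da.
by rewrite mulrC derive1E.
Qed.

Lemma Cdiff_affine k f c d : Cdiff k f -> Cdiff k (fun x => f (c * x + d)).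
Proof.
elim: k f => [|k IHk] f cf.
  by split => // x; case: (is_derive_affine (@Cdiff_derivable 0 f (c * x + d) cf)).
apply: is_derive_CdiffS => [x|].
  by apply: is_derive_affine; exact: Cdiff_derivable cf.
apply: (CdiffM (f := cst c)); first exact: Cdiff_cst.
by apply: IHk; case: cf.
Qed.

(* The derivative of [flat n] is a linear combination of [flat n.+1] and
   [flat n.+2]; this is why the whole family is kept instead of [flat 0] alone. *)
Definition flat n x : R := if 0 < x then x^-1 ^+ n * expR (- x^-1) else 0.

Lemma flat_ge0 n x : 0 <= flat n x.
Proof.
rewrite /flat; case: ifPn => // x0.
by rewrite mulr_ge0 ?expR_ge0// exprn_ge0// invr_ge0 ltW.
Qed.

Lemma flatS n x : flat n x = flat n.+1 x * x.
Proof.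
rewrite /flat; case: ifPn => x0; last by rewrite mul0r.
by rewrite exprSr mulrAC -[_ / x * x]mulrA mulVf ?gt_eqF// mulr1.
Qed.

(** This is [1 + u ^+ n.+1 / n.+1! <= expR u] at [u = x^-1]. It gives both differentiability of
    [flat] at 0 and, after [x = t^-1], the decay of the Gamma integrand. *)
Lemma flat_le n x : flat n x <= n.+1`!%:R * `|x|.
Proof.
rewrite /flat; case: ifPn => x0; last by rewrite mulr_ge0.
rewrite gtr0_norm//.
have xV0 : 0 < x^-1 by rewrite invr_gt0.
have := expR_ge1Dxn n (ltW xV0); set f := _`!%:R => le_exp.
have f0 : 0 < f by rewrite ltr0n fact_gt0.
rewrite expRN ler_pdivrMr ?expR_gt0//.
apply: (@le_trans _ _ (f * x * (x^-1 ^+ n.+1 / f))).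
  rewrite exprS; rewrite le_eqVlt; apply/orP; left; apply/eqP.
  by field; rewrite !gt_eqF.
rewrite ler_wpM2l//; first by rewrite mulr_ge0 ?ltW.
by apply: le_trans le_exp; rewrite lerDr.
Qed.

Lemma is_derive_flat n x :
  is_derive x 1 (flat n) (flat n.+2 x - n%:R * flat n.+1 x).
Proof.
have [x0|x0|<-] := ltgtP 0 x.
- apply: (@near_eq_is_derive _ _ _ (fun x => x^-1 ^+ n * expR (- x^-1))) => //.
    by near=> y; rewrite /flat ifT//; near: y; exact: lt_nbhsr.
  have x0' : x != 0 by rewrite gt_eqF.
  have dV : is_derive x 1 (fun x => x^-1) (- x ^- 2).
    have := is_deriveV (x0' : id x != 0) (is_derive_id x 1).
    by rewrite /GRing.scale/= mulr1.
  have dE : is_derive x 1 (fun x => expR (- x^-1)) (expR (- x^-1) * x ^- 2).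
    apply: (@is_derive1_comp _ expR (fun x => - x^-1)).
    by apply: is_derive_eq; rewrite opprK.
  have dX : is_derive x 1 (fun x => x^-1 ^+ n) (n%:R * x^-1 ^+ n.-1 * - x ^- 2).
    by have := @is_deriveX _ _ (fun y : R => y^-1) n x 1 _ dV; rewrite exprfctE.
  have := is_deriveM dX dE; rewrite /flat x0 /GRing.scale /=.
  rewrite (_ : (fun y : R => y^-1 ^+ n) * _ = fun y => y^-1 ^+ n * expR (- y^-1)) //.
  move=> dM; apply: (is_derive_eq dM).
  case: n {dX dM} => [|n] /=; rewrite !exprVn ?exprS; field => //.
  by rewrite expf_neq0.
- apply: (@near_eq_is_derive _ _ _ (cst 0)) => //.
    near=> y; rewrite /flat ifF//; apply/negbTE; rewrite -leNgt ltW//; near: y.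
    exact: lt_nbhsl.
  by apply: is_derive_eq; rewrite /flat !ifF ?mulr0 ?subr0// le_gtF// ltW.
(* At 0 the difference quotient of [flat n] is [flat n.+1] by [flatS], and [flat_le] makes it
   continuous there with value 0. *)
- apply/is_derive1_caratheodory; exists (flat n.+1); split.
  + by move=> z; rewrite [flat n 0]/flat ltxx !subr0 -flatS.
  + have fl0 : flat n.+1 0 = 0 by rewrite /flat ltxx.
    rewrite /prop_for /continuous_at fl0.
    apply: (@squeeze_cvgr _ _ _ _ (cst 0) (fun z => n.+2`!%:R * `|z|)).
    * by apply: nearW => z /=; rewrite flat_ge0 flat_le.
    * exact: cvg_cst.
    * rewrite -[X in _ --> X](mulr0 (n.+2`!%:R : R)); apply: cvgM; first exact: cvg_cst.
      rewrite -[X in _ --> X](normr0 R); apply: cvg_norm; exact: cvg_id.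
  + by rewrite /flat ltxx mulr0 subr0.
Unshelve. all: by end_near. Qed.

Lemma Cdiff_flat k n : Cdiff k (flat n).
Proof.
elim: k n => [|k IHk] n; first by split => // x; case: (is_derive_flat n x).
apply: is_derive_CdiffS; first exact: is_derive_flat.
apply: CdiffB => //; apply: (CdiffM (f := cst n%:R)) => //; exact: Cdiff_cst.
Qed.

Lemma flat0_gt0 x : 0 < x -> 0 < flat 0 x.
Proof. by move=> x0; rewrite /flat x0 expr0 mul1r expR_gt0. Qed.

Lemma flat_le0 n x : x <= 0 -> flat n x = 0.
Proof. by move=> x0; rewrite /flat ifF// le_gtF. Qed.

Lemma smooth_step_exists : exists S : R -> R,
  [/\ forall k x, derivable (derive1n k S) x 1,
      forall x, x <= 0 -> S x = 0,
      forall x, 1 <= x -> S x = 1 &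
      forall x, 0 <= S x <= 1].
Proof.
(* The step is [flat 0 x] over [flat 0 x + flat 0 (1 - x)]; one of [x] and [1 - x] is always
   positive, so the denominator never vanishes. *)
pose den x := flat 0 x + flat 0 (- 1 * x + 1).
have den_gt0 x : 0 < den x.
  have [x0|x0] := ltP 0 x; first by rewrite ltr_pwDl// ?flat0_gt0// flat_ge0.
  by rewrite ltr_wpDl ?flat_ge0// flat0_gt0// mulN1r; lra.
exists (fun x => flat 0 x * (den x)^-1); split.
- apply/CdiffP => k; apply: CdiffM; first exact: Cdiff_flat.
  apply: CdiffV; first by move=> x; rewrite gt_eqF.
  by apply: CdiffD; [|apply: Cdiff_affine]; exact: Cdiff_flat.
- by move=> x x0; rewrite flat_le0// mul0r.
- move=> x x1; rewrite /den [flat 0 (_ + _)]flat_le0; last by rewrite mulN1r; lra.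
  by rewrite addr0 divff// gt_eqF// flat0_gt0//; lra.
- move=> x; rewrite divr_ge0 ?flat_ge0 ?(ltW (den_gt0 _))//=.
  by rewrite ler_pdivrMr// mul1r lerDl flat_ge0.
Qed.

End SmoothStep.

(** * Rescaled steps and bounds on their derivatives *)

Section StepDerivatives.
Context {R : realType}.
Implicit Types (s : R -> R) (c d x B : R).

Definition is_step c d s : Prop :=
  [/\ forall k x, derivable (derive1n k s) x 1,
      forall x, x <= c -> s x = 0,
      forall x, d <= x -> s x = 1 &
      forall x, 0 <= s x <= 1].

(** Such an [x] is a global minimum (value 0) or maximum (value 1) of [s], hence a critical point.
    The argument covers the endpoints [c] and [d], where [s] is constant on one side only. *)
Lemma step_derive1_eq0 c d s x : is_step c d s -> (x <= c) || (d <= x) ->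
  derive1 s x = 0.
Proof.
case=> smooth s0 s1 s01 xcd.
have xx : x \in `]x - 1, x + 1[%R by rewrite in_itv/=; lra.
have xx' : x - 1 <= x + 1 by lra.
have ds t : t \in `]x - 1, x + 1[%R -> derivable s t 1 by move=> _; exact: (smooth 0%N).
rewrite derive1E; case/orP: xcd => [xc|dx].
- have [//|_ ->//] := derive1_at_min xx' ds xx _.
  by move=> t _; rewrite (s0 x xc); case/andP: (s01 t).
- have [//|_ ->//] := derive1_at_max xx' ds xx _.
  by move=> t _; rewrite (s1 x dx); case/andP: (s01 t).
Qed.

Lemma step_derive2_eq0 c d s x : is_step c d s -> (x < c) || (d < x) ->
  derive1n 2 s x = 0.
Proof.
move=> st xcd; rewrite derive1nS derive1E (@near_eq_derive _ _ _ _ (cst 0)).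
  exact: derive_cst.
case/orP: xcd => [xc|dx]; near=> t; rewrite derive1n1; apply: (step_derive1_eq0 st).
- by apply/orP; left; apply: ltW; near: t; exact: lt_nbhsl.
- by apply/orP; right; apply: ltW; near: t; exact: lt_nbhsr.
Unshelve. all: by end_near. Qed.

Lemma derivable_continuous (f : R -> R) x : derivable f x 1 -> {for x, continuous f}.
Proof. by move=> /derivable1_diffP /differentiable_continuous. Qed.

(** A single step on [[0, 1]] is rescaled affinely; the chain rule contributes the factor
    [(d - c)^-1], and [B] is the maximum of the absolute slope of the original step, the same for
    all intervals. *)
Lemma steps_exist : exists2 B : R, 0 <= B & forall c d, c < d ->
  exists2 s, is_step c d s & forall x, `|derive1 s x| <= B / (d - c).
Proof.
have [S stS] : exists S : R -> R, is_step 0 1 S by exact: smooth_step_exists.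
have [smS S0 S1 S01] := stS.
have [|m m01 Smax] := @EVT_max _ (fun x => `|derive1 S x|) 0 1 ler01.
  apply: continuous_in_subspaceT => x _; apply: continuous_comp; last exact: norm_continuous.
  by apply: derivable_continuous; exact: (smS 1%N).
exists `|derive1 S m| => // c d cd.
have dc0 : 0 < d - c by rewrite subr_gt0.
have affE x : (d - c)^-1 * x + - c / (d - c) = (x - c) / (d - c).
  by field; rewrite gt_eqF.
exists (fun x => S ((d - c)^-1 * x + - c / (d - c))).
  split.
  - by apply/CdiffP => k; apply: Cdiff_affine; move: k; apply/CdiffP.
  - move=> x xc; rewrite affE S0//; apply: mulr_le0_ge0; first by rewrite subr_le0.
    by rewrite invr_ge0 ltW.
  - by move=> x dx; rewrite affE S1// ler_pdivlMr// mul1r lerB.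
  - by move=> x; exact: S01.
move=> x; have [_] := is_derive_affine (smS 0%N ((d - c)^-1 * x + - c / (d - c))).
rewrite -derive1E => ->.
rewrite normrM gtr0_norm ?invr_gt0// mulrC ler_wpM2r ?invr_ge0 ?(ltW dc0)//.
set z := _ + _; have [z01|] := boolP (z \in `[0, 1]%R); first exact: Smax.
rewrite in_itv/= negb_and -!ltNge => z01.
rewrite (step_derive1_eq0 stS) ?normr0//.
by case/orP: z01 => /ltW ->; rewrite ?orbT.
Qed.

End StepDerivatives.

(** * Increments of a derivative and the weak second derivative *)

Section IncrementBound.
Context {R : realType}.
Local Notation mu := (@lebesgue_measure R).
Implicit Types (f g y dy s : R -> R) (a b c d x B T : R).

Lemma Rintegral_support (D A : set R) f : A `<=` D ->
  (forall x, D x -> ~ A x -> f x = 0) ->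
  \int[mu]_(x in D) f x = \int[mu]_(x in A) f x.
Proof.
move=> AD f0; rewrite Rintegral_mkcond [RHS]Rintegral_mkcond.
congr Rintegral; apply/funext => x; rewrite !patchE.
have [xA|xA] := boolP (x \in A); first by rewrite mem_set//; apply: AD; exact/set_mem.
case: ifPn => // /set_mem xD; apply: f0 => //.
by move=> /mem_set; apply/negP.
Qed.

Lemma within_continuousM (A : set R) f g : {within A, continuous f} ->
  {within A, continuous g} -> {within A, continuous (fun x => f x * g x)}.
Proof.
move=> /subspace_continuousP cf /subspace_continuousP cg.
by apply/subspace_continuousP => x Ax; apply: cvgM; [exact: cf|exact: cg].
Qed.

Lemma within_continuous_norm (A : set R) f : {within A, continuous f} ->
  {within A, continuous (fun x => `|f x|)}.
Proof.
move=> /subspace_continuousP cf.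
by apply/subspace_continuousP => x Ax; apply: cvg_norm; exact: cf.
Qed.

Lemma within_continuous_cst (A : set R) c : {within A, continuous (fun=> c)}.
Proof. by apply: continuous_subspaceT => x; exact: cst_continuous. Qed.

Lemma derivable_oo_LRcontinuous_itv f a b : (forall x, derivable f x 1) ->
  derivable_oo_LRcontinuous f a b.
Proof.
move=> df; split => [x _|  |]; first exact: df.
  by apply: cvg_at_right_filter; exact: derivable_continuous.
by apply: cvg_at_left_filter; exact: derivable_continuous.
Qed.

(* [int y s'' = - int y' s'], and [s'] has mass 1 on [[c, d]]. *)
Lemma step_derive2_integral c d s B y dy m e : c < d -> is_step c d s ->
  (forall x, `|derive1 s x| <= B / (d - c)) ->
  {within `[c, d], continuous dy} -> derivable_oo_LRcontinuous y c d ->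
  {in `]c, d[, derive1 y =1 dy} ->
  (forall t, t \in `[c, d]%R -> `|dy t - m| <= e) ->
  `|\int[mu]_(t in `[c, d]) (y t * derive1n 2 s t) + m| <= e * B.
Proof.
move=> cd st sB cdy dy1 dy2 me; have [sms s0 s1 _] := st.
have dc0 : 0 < d - c by rewrite subr_gt0.
have cs k : {within `[c, d], continuous (derive1n k s)}.
  by apply: continuous_in_subspaceT => x _; exact/derivable_continuous/sms.
(* Both boundary terms carry [derive1 s] at [c] or [d], where it vanishes. *)
rewrite (@Rintegration_by_parts _ _ (derive1n 1 s) dy) //; last first.
  exact/derivable_oo_LRcontinuous_itv/(sms 1%N).
rewrite derive1n1 !(step_derive1_eq0 st) ?lexx ?orbT// !mulr0 subrr sub0r.
have I1 : \int[mu]_(t in `[c, d]) derive1 s t = 1.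
  rewrite /Rintegral (@continuous_FTC2 _ _ s) //.
  + by rewrite -EFinB /= (s0 c)// (s1 d)// subr0.
  + exact: (cs 1%N).
  + exact/derivable_oo_LRcontinuous_itv/(sms 0%N).
have int1 (f : R -> R) : {within `[c, d], continuous f} ->
    mu.-integrable `[c, d] (EFin \o f).
  by move=> cf; apply: continuous_compact_integrable => //; exact: segment_compact.
have cm : {within `[c, d], continuous (fun t => (dy t - m) * derive1 s t)}.
  apply: within_continuousM; last exact: (cs 1%N).
  by apply: within_continuousB => //; exact: within_continuous_cst.
have -> : - (\int[mu]_(t in `[c, d]) (dy t * derive1 s t)) + m =
    - \int[mu]_(t in `[c, d]) ((dy t - m) * derive1 s t).
  rewrite -[X in _ + X = _]mulr1 -[X in m * X]I1 -RintegralZl//; last exact/int1/(cs 1%N).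
  rewrite addrC -opprB; congr (- _).
  rewrite -RintegralB//.
  - by apply: eq_Rintegral => t _; rewrite mulrBl.
  - by apply: int1; apply: within_continuousM => //; exact: (cs 1%N).
  - apply: int1; apply: within_continuousM; last exact: (cs 1%N).
    exact: within_continuous_cst.
rewrite normrN; apply: (le_trans (le_normr_Rintegral _ (int1 _ cm))) => //.
apply: (@le_trans _ _ (\int[mu]_(t in `[c, d]) (e * (B / (d - c))))).
  apply: le_Rintegral => //.
  - by apply: int1; exact: within_continuous_norm.
  - by apply: int1; exact: within_continuous_cst.
  - by move=> t tcd; rewrite normrM ler_pM//; exact: me.
rewrite Rintegral_cst//= lebesgue_measure_itv/= lte_fin cd /=.
by rewrite le_eqVlt; apply/orP; left; apply/eqP; field; rewrite gt_eqF.
Qed.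

Lemma norm_integral_le_support (D A : set R) f (phi : R -> R) : measurable D -> measurable A ->
  A `<=` D -> measurable_fun D f -> measurable_fun D phi ->
  (forall x, `|phi x| <= 1) -> (forall x, D x -> ~ A x -> phi x = 0) ->
  (`|\int[mu]_(t in D) (f t * phi t)|%:E <= \int[mu]_(t in A) `|f t|%:E)%E.
Proof.
move=> mD mA AD mf mphi phi1 phi0.
have mfphi : measurable_fun D (fun t => f t * phi t) by exact: measurable_funM.
apply: (@le_trans _ _ (\int[mu]_(t in D) `|f t * phi t|%:E)%E).
  apply: (@le_trans _ _ (`|\int[mu]_(t in D) (f t * phi t)%:E|)%E).
    (* [Rintegral] sends an infinite integral to 0, so the inequality holds in that case too. *)
    by rewrite /Rintegral; case: (integral _ _ _) => [r| |]//=; rewrite normr0 leey.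
  by apply: le_abse_integral => //; exact/measurable_EFinP.
rewrite [leRHS]integral_mkcond/= [leLHS]integral_mkcond/=.
have mAf : measurable_fun A f by exact: measurable_funS mf.
apply: ge0_le_integral => //.
- by move=> x _; rewrite patchE; case: ifPn => // _; rewrite lee_fin.
- apply/(measurable_restrictT _ mD); apply/measurable_EFinP.
  by apply: measurableT_comp.
- apply/(measurable_restrictT _ mA); apply/measurable_EFinP.
  by apply: measurableT_comp.
- move=> x _; rewrite !patchE; have [xA|xA] := boolP (x \in A).
    rewrite mem_set; last exact/AD/set_mem.
    by rewrite lee_fin normrM ler_piMr.
  case: ifPn => // /set_mem xD; rewrite phi0 ?mulr0 ?normr0//.
  by move=> /mem_set; apply/negP.
Qed.

(** The test function is [s1 - s2], where [s1] rises just after [a] and [s2] just before [b].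
    Integrating [y] against its second derivative gives nearly [dy b - dy a] by
    [step_derive2_integral], while the weak derivative turns it into the integral of [g * phi] with
    [phi] bounded by 1 and supported in [[a, b]]. *)
Lemma weak_derivative2_increment T y dy g a b : 0 < a -> a < b -> b < T ->
  {in `]0, T[, forall x, derivable y x 1} -> {in `]0, T[, continuous dy} ->
  {in `]0, T[, derive1 y =1 dy} ->
  is_weak_derivative T 2 y g ->
  (`|dy b - dy a|%:E <= \int[mu]_(t in `]a, b[) `|g t|%:E)%E.
Proof.
move=> a0 ab bT dy1 cdy ydy [_ [mg _ _] weak].
have [B B0 steps] := @steps_exist R.
have abT : {subset `[a, b]%R <= `]0, T[%R}.
  move=> x; rewrite !in_itv/= => /andP[ax xb].
  by rewrite (lt_le_trans a0 ax) (le_lt_trans xb bT).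
have sub0T c d : a <= c -> d <= b -> {subset `[c, d]%R <= `]0, T[%R}.
  move=> ac db x; rewrite in_itv/= => /andP[cx xd]; apply: abT.
  by rewrite in_itv/= (le_trans ac)//= (le_trans xd).
(* Here [e] bounds the oscillation of [dy] on the two ramps; each ramp then contributes an error of
   at most [e * B]. *)
suff key e : 0 < e ->
    (`|dy b - dy a|%:E <= \int[mu]_(t in `]a, b[) `|g t|%:E + (e * B * 2)%:E)%E.
  apply/lee_addgt0Pr => e e0.
  (* [B] is only known to be nonnegative, so [e] is divided by [B + 1]. *)
  have B1 : 0 < B + 1 by lra.
  apply: le_trans (key (e / 2 / (B + 1)) _) _; first by rewrite !divr_gt0.
  rewrite leeD2l// lee_fin.
  have -> : e / 2 / (B + 1) * B * 2 = e * (B / (B + 1)) by field; rewrite gt_eqF.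
  by rewrite ler_piMr ?(ltW e0)// ler_pdivrMr// mul1r; lra.
move=> e0.
have [d [d0 dba da db]] : exists d, [/\ 0 < d, a + d < b - d,
    forall t, t \in `[a, a + d]%R -> `|dy t - dy a| <= e &
    forall t, t \in `[b - d, b]%R -> `|dy t - dy b| <= e].
  have aT : a \in `]0, T[ by rewrite in_itv/= a0 (lt_trans ab).
  have bT' : b \in `]0, T[ by rewrite in_itv/= bT (lt_trans a0).
  have /cvgrPdist_le /(_ e e0) /nbhs_ballP [ra /= ra0 Ha] := cdy a aT.
  have /cvgrPdist_le /(_ e e0) /nbhs_ballP [rb /= rb0 Hb] := cdy b bT'.
  (* The halves keep the closed ramps inside the open balls of continuity; the third keeps the two
     ramps disjoint. *)
  exists (Num.min (Num.min (ra / 2) (rb / 2)) ((b - a) / 3)).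
  set d := Num.min _ _.
  have [d1 d2 d3] : [/\ d <= ra / 2, d <= rb / 2 & d <= (b - a) / 3].
    by rewrite /d !ge_min !lexx ?orbT.
  split.
  - by rewrite !lt_min !divr_gt0// subr_gt0.
  - by lra.
  - move=> t; rewrite in_itv/= => tad; rewrite distrC; apply: Ha.
    by rewrite /ball/= ltr_norml; lra.
  - move=> t; rewrite in_itv/= => tad; rewrite distrC; apply: Hb.
    by rewrite /ball/= ltr_norml; lra.
have aad : a < a + d by lra.
have bdb : b - d < b by lra.
have adb : a + d <= b by lra.
have abd : a <= b - d by lra.
have [s1 st1 s1B] := steps _ _ aad.
have [s2 st2 s2B] := steps _ _ bdb.
have [sm1 s10 s11 s101] := st1.
have [sm2 s20 s21 s201] := st2.
pose phi := s1 \- s2.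
have dphi k : derive1n k phi = derive1n k s1 \- derive1n k s2.
  elim: k => // k IHk; rewrite !derive1nS IHk; apply: is_derive_derive1 => x.
  by rewrite /= !derive1E; apply: is_deriveB; apply/derivableP.
have test : test_function T phi.
  split=> [k x|]; first by rewrite dphi; apply: derivableB.
  exists `[a, b]%classic; split => [|x /abT//|x]; first exact: segment_compact.
  move=> /negP; rewrite in_itv/= negb_and -!ltNge => /orP[xa|bx]; rewrite /phi/=.
    by rewrite s10 ?s20 ?subrr//; lra.
  by rewrite s11 ?s21 ?subrr//; lra.
have phi1 x : `|phi x| <= 1.
  rewrite /phi/=; have := s101 x; have := s201 x; rewrite ler_norml.
  have [xad|adx] := leP x (a + d); first by rewrite (s20 x); lra.
  by rewrite (s11 x); lra.
have phi0 x : ~ `]a, b[%classic x -> phi x = 0.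
  move/negP; rewrite in_itv/= negb_and -!leNgt => /orP[xa|bx]; rewrite /phi/=.
    by rewrite s10 ?s20 ?subrr//; lra.
  by rewrite s11 ?s21 ?subrr//; lra.
have := weak _ test; rewrite sqrrN expr1n mul1r => ibp.
have cdy' c c' : a <= c -> c' <= b -> {within `[c, c'], continuous dy}.
  move=> ac cb; apply: continuous_in_subspaceT => x /set_mem xcc.
  by apply: cdy; exact: sub0T xcc.
have cy c c' : a <= c -> c' <= b -> {within `[c, c'], continuous y}.
  move=> ac cb; apply: derivable_within_continuous => x xcc.
  by apply: dy1; exact: sub0T xcc.
have c2 k (s : R -> R) : (forall k x, derivable (derive1n k s) x 1) ->
    {within `[a, b], continuous (fun t => y t * derive1n k s t)}.
  move=> sm; apply: within_continuousM; first exact: cy.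
  by apply: continuous_in_subspaceT => x _; exact/derivable_continuous/sm.
have int1 (f : R -> R) : {within `[a, b], continuous f} ->
    mu.-integrable `[a, b] (EFin \o f).
  by move=> cf; apply: continuous_compact_integrable => //; exact: segment_compact.
have out c c' x : ~ `[c, c']%classic x -> (x < c) || (c' < x).
  by move/negP; rewrite in_itv/= negb_and -!ltNge.
(* The second derivative of each step lives on its own ramp, so the integral splits into two to
   which [step_derive2_integral] applies. *)
have split_phi : \int[mu]_(t in `]0, T[) (y t * derive1n 2 phi t) =
    \int[mu]_(t in `[a, (a + d)]) (y t * derive1n 2 s1 t) -
    \int[mu]_(t in `[(b - d), b]) (y t * derive1n 2 s2 t).
  have dphi2 t : derive1n 2 phi t = derive1n 2 s1 t - derive1n 2 s2 t by rewrite dphi.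
  under eq_Rintegral do rewrite dphi2.
  rewrite (@Rintegral_support _ `[a, b]); last 2 first.
  - by move=> x /abT.
  - move=> x _ /out xab.
    rewrite (step_derive2_eq0 st1) ?(step_derive2_eq0 st2) ?subrr ?mulr0//;
      by case/orP: xab => ?; apply/orP; [left|right]; lra.
  under eq_Rintegral do rewrite mulrBr.
  rewrite RintegralB//; [|exact/int1/c2|exact/int1/c2].
  congr (_ - _); apply: Rintegral_support.
  - by move=> x /=; rewrite !in_itv/=; lra.
  - move=> x _ /out xab.
    by rewrite (step_derive2_eq0 st1)// mulr0.
  - by move=> x /=; rewrite !in_itv/=; lra.
  - move=> x _ /out xab.
    by rewrite (step_derive2_eq0 st2)// mulr0.
have LR c c' : a <= c -> c < c' -> c' <= b -> derivable_oo_LRcontinuous y c c'.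
  move=> ac cc' cb; have ccT := sub0T _ _ ac cb.
  split => [x xcc||].
  - by apply: dy1; apply: ccT; exact: subset_itv_oo_cc.
  - apply/cvg_at_right_filter/derivable_continuous/dy1/ccT.
    by rewrite in_itv/= lexx ltW.
  - apply/cvg_at_left_filter/derivable_continuous/dy1/ccT.
    by rewrite in_itv/= lexx ltW.
have ydy' c c' : a <= c -> c' <= b -> {in `]c, c'[, derive1 y =1 dy}.
  by move=> ac cb x xcc; apply: ydy; apply: (sub0T _ _ ac cb); exact: subset_itv_oo_cc.
have X1 := step_derive2_integral aad st1 s1B (cdy' _ _ (lexx a) adb)
  (LR _ _ (lexx a) aad adb) (ydy' _ _ (lexx a) adb) da.
have X2 := step_derive2_integral bdb st2 s2B (cdy' _ _ abd (lexx b))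
  (LR _ _ abd bdb (lexx b)) (ydy' _ _ abd (lexx b)) db.
move: ibp; rewrite split_phi; move: X1 X2.
set X1 := Rintegral _ _ _; set X2 := Rintegral _ _ _ => X1B X2B X12.
have : (`|X1 - X2|%:E <= \int[mu]_(t in `]a, b[) `|g t|%:E)%E.
  rewrite X12; apply: norm_integral_le_support => //.
  - by move=> x xab; apply: abT; exact: subset_itv_oo_cc.
  - apply: measurable_funTS; apply: continuous_measurable_fun => x.
    apply: derivable_continuous; rewrite -[phi](derive1n0).
    by rewrite dphi; apply: derivableB.
  - by move=> x _ /phi0.
move=> X12le; apply: (@le_trans _ _ (`|X1 - X2|%:E + (e * B * 2)%:E)%E).
  rewrite -EFinD lee_fin.
  have -> : dy b - dy a = (X1 - X2) + ((X2 + dy b) - (X1 + dy a)) by ring.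
  apply: (le_trans (ler_normD _ _)); rewrite lerD2l mulr_natr mulr2n.
  by apply: (le_trans (ler_normB _ _)); exact: lerD.
by rewrite leeD2r.
Qed.

End IncrementBound.

(** * Integrals over open intervals *)

Section OpenIntervals.
Context {R : realType}.
Local Notation mu := (@lebesgue_measure R).
Implicit Types (f F : R -> R) (a b x : R) (u v : R^nat).

Lemma harmonic_nonincreasing m n : (m <= n)%N -> harmonic n <= harmonic m :> R.
Proof. by move=> mn; rewrite /= lef_pV2 ?posrE// ler_nat ltnS. Qed.

(** Monotone convergence along compact intervals; it carries the calculus on segments over to
    integrands singular at an endpoint and to the half-line of the Gamma integral. *)
Lemma ge0_integral_exhaustion (A : set R) u v f : measurable A ->
  (forall m n, (m <= n)%N -> u n <= u m /\ v m <= v n) ->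
  (forall n, `[u n, v n] `<=` A) ->
  (forall x, A x -> \forall n \near \oo, u n <= x <= v n) ->
  measurable_fun A f -> (forall x, A x -> 0 <= f x) ->
  (\int[mu]_(x in `[u n, v n]) (f x)%:E @[n --> \oo] -->
   \int[mu]_(x in A) (f x)%:E)%E.
Proof.
move=> mA uv uvA exA mf f0.
have AE : A = \bigcup_n `[u n, v n]%classic.
  apply/seteqP; split => [x /exA|x [n _ /uvA//]].
  by move=> /(@filter_ex _ _ _) [n /= xn]; exists n => //=; rewrite in_itv.
rewrite AE.
apply: ge0_nondecreasing_set_cvg_integral => //.
- move=> m n mn; apply/subsetPset => x /=; have [un vn] := uv _ _ mn.
  by rewrite !in_itv/= => /andP[/(le_trans un) -> /le_trans ->].
- by move=> n; apply/measurable_EFinP; exact: measurable_funS mf.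
- by move=> n x /uvA Ax; rewrite lee_fin f0.
Qed.

Lemma continuous_oo_measurable_fun a b f : {in `]a, b[, continuous f} ->
  measurable_fun `]a, b[ f.
Proof.
move=> cf; apply: open_continuous_measurable_fun; first exact: interval_open.
by move=> x; rewrite inE => /cf.
Qed.

(** The integrand may blow up at either endpoint: the fundamental theorem is applied on inner
    segments, and both sides pass to the limit, the right one by the one-sided limits of [F]. *)
Lemma ge0_FTC2_oo f F a b : a < b ->
  {in `]a, b[, forall x, is_derive x 1 F (f x)} -> {in `]a, b[, continuous f} ->
  {in `]a, b[, forall x, 0 <= f x} ->
  F x @[x --> a^'+] --> F a -> F x @[x --> b^'-] --> F b ->
  (\int[mu]_(x in `]a, b[) (f x)%:E = (F b - F a)%:E)%E.
Proof.
move=> ab dF cf f0 Fa Fb.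
(* As [harmonic 0] is 1, the margin of one third makes already the first segment nondegenerate. *)
have ba3 : 0 < (b - a) / 3 by rewrite divr_gt0// subr_gt0.
pose u (n : nat) := a + (b - a) / 3 * harmonic n.
pose v (n : nat) := b - (b - a) / 3 * harmonic n.
have ch : ((b - a) / 3 * harmonic n @[n --> \oo] --> (0 : R)).
  by rewrite -(mulr0 ((b - a) / 3)); apply: cvgMr; exact: cvg_harmonic.
have ua : u n @[n --> \oo] --> a.
  by rewrite -[X in _ --> X]addr0; apply: cvgD => //; exact: cvg_cst.
have vb : v n @[n --> \oo] --> b.
  by rewrite -[X in _ --> X]subr0; apply: cvgB => //; exact: cvg_cst.
have h0 n : 0 < (b - a) / 3 * harmonic n by rewrite mulr_gt0// harmonic_gt0.
have h1 n : (b - a) / 3 * harmonic n <= (b - a) / 3.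
  rewrite ler_piMr//; first exact: ltW.
  by rewrite (le_trans (harmonic_nonincreasing (leq0n n)))//= invr1.
have au n : a < u n by rewrite /u; have := h0 n; lra.
have vb' n : v n < b by rewrite /v; have := h0 n; lra.
have uvn n : u n < v n by rewrite /u /v; have := h1 n; lra.
have sub n : {subset `[u n, v n]%R <= `]a, b[%R}.
  move=> x; rewrite !in_itv/= => /andP[ux xv].
  by rewrite (lt_le_trans (au n))//= (le_lt_trans xv).
have : (\int[mu]_(x in `[u n, v n]) (f x)%:E @[n --> \oo] -->
   \int[mu]_(x in `]a, b[) (f x)%:E)%E.
  apply: ge0_integral_exhaustion => //.
  - move=> m n mn; rewrite /u /v lerD2l lerB// ler_pM2l ?ler_wpM2l//;
      by rewrite ?harmonic_nonincreasing// ltW.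
  - move=> x xab; have /andP[ax xb] : a < x < b by move: xab; rewrite /= in_itv.
    near=> n.
    apply/andP; split; apply: ltW; near: n.
      exact: (cvgr_lt _ ua).
    exact: (cvgr_gt _ vb).
  - exact: continuous_oo_measurable_fun.
have -> : (fun n => \int[mu]_(x in `[u n, v n]) (f x)%:E)%E =
    (fun n => (F (v n) - F (u n))%:E).
  apply/funext => n; rewrite EFinB; apply: continuous_FTC2 => //.
  - apply: continuous_in_subspaceT => x /set_mem/= xn.
    by apply: cf; exact: sub xn.
  - have dF' x : x \in `[u n, v n]%R -> {for x, continuous F}.
      by move=> /sub /dF [dFx _]; exact: derivable_continuous.
    split => [x xn||].
    + by have [] := dF x (sub n _ (subset_itv_oo_cc xn)).
    + by apply: cvg_at_right_filter; apply: dF'; rewrite in_itv/= lexx ltW.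
    + by apply: cvg_at_left_filter; apply: dF'; rewrite in_itv/= lexx ltW.
  - move=> x xn; rewrite derive1E.
    by have [_ ->] := dF x (sub n _ (subset_itv_oo_cc xn)).
move=> intf.
have : (F (v n) - F (u n))%:E @[n --> \oo] --> (F b - F a)%:E.
  apply/cvg_EFin; first exact: nearW.
  apply: cvgB.
    by move/cvg_at_leftP : Fb; apply; split.
  by move/cvg_at_rightP : Fa; apply; split.
move=> intF; exact: (cvg_unique _ intf intF).
Unshelve. all: by end_near. Qed.

End OpenIntervals.

(** * Integrals of powers and a pointwise bound for the logarithm *)

Section PowerIntegrals.
Context {R : realType}.
Local Notation mu := (@lebesgue_measure R).
Implicit Types (a b c r x t tau T : R).

Lemma powR_at_right a r : 0 <= a -> 0 < r -> x `^ r @[x --> a^'+] --> a `^ r.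
Proof.
rewrite le_eqVlt => /predU1P[<- r0|a0 _].
  by rewrite powR0 ?gt_eqF//; exact: powR_cvg0.
apply: cvg_at_right_filter.
have [dp _] := is_derive1_powR r a0.
exact: derivable_continuous dp.
Qed.

Lemma is_derive_mull (f : R -> R) k x d : is_derive x 1 f d ->
  is_derive x 1 (fun x => k * f x) (k * d).
Proof. by move=> df; exact: (is_deriveZ k df). Qed.

Lemma is_derive_powR_subr c r x : x < c ->
  is_derive x 1 (fun x => (c - x) `^ r) (- (r * (c - x) `^ (r - 1))).
Proof.
move=> xc; have cx : 0 < c - x by rewrite subr_gt0.
have dg : is_derive x 1 (fun x => c - x) (- 1).
  by rewrite -[- 1]sub0r; apply: is_deriveB.
have := @is_derive1_comp _ (@powR R ^~ r) (fun x => c - x) _ _ _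
  (is_derive1_powR r cx) dg.
by rewrite mulrN1.
Qed.

Lemma powR_subr_at_left b c r : b <= c -> 0 < r ->
  (c - x) `^ r @[x --> b^'-] --> (c - b) `^ r.
Proof.
move=> bc r0; apply/cvg_at_leftP => u [ub cu].
have /cvg_at_rightP : x `^ r @[x --> (c - b)^'+] --> (c - b) `^ r.
  by apply: powR_at_right => //; rewrite subr_ge0.
apply; split => [n|]; first by rewrite ltrD2l ltrN2.
by apply: cvgB => //; exact: cvg_cst.
Qed.

(** For [b = c] and [r < 1] the integrand is singular at the right end; there only the left limit of
    the antiderivative enters. *)
Lemma integral_powR_subr a b c r : a < b -> b <= c -> 0 < r ->
  (\int[mu]_(x in `]a, b[) ((c - x) `^ (r - 1))%:E =
   (((c - a) `^ r - (c - b) `^ r) / r)%:E)%E.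
Proof.
move=> ab bc r0.
have xc x : x \in `]a, b[%R -> x < c.
  by rewrite in_itv/= => /andP[_ xb]; exact: lt_le_trans bc.
pose F x := - r^-1 * (c - x) `^ r.
rewrite (@ge0_FTC2_oo _ _ F)//.
- by congr EFin; rewrite /F; field; rewrite gt_eqF.
- move=> x /xc /is_derive_powR_subr -/(_ r) dx.
  by apply: (is_derive_eq (is_derive_mull _ dx)); field; rewrite gt_eqF.
- move=> x /xc /is_derive_powR_subr -/(_ (r - 1)) [dx _].
  exact: derivable_continuous dx.
- by move=> x _; exact: powR_ge0.
- apply: cvg_at_right_filter; have [dp _] := is_derive_powR_subr r (lt_le_trans ab bc).
  by apply: cvgM; [exact: cvg_cst|exact: derivable_continuous dp].
- by apply: cvgM; [exact: cvg_cst|exact: powR_subr_at_left].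
Qed.

Lemma integral_powR a b r : 0 <= a -> a < b -> 0 < r ->
  (\int[mu]_(x in `]a, b[) (x `^ (r - 1))%:E = ((b `^ r - a `^ r) / r)%:E)%E.
Proof.
move=> a0 ab r0.
have x0 x : x \in `]a, b[%R -> 0 < x.
  by rewrite in_itv/= => /andP[ax _]; exact: le_lt_trans ax.
pose F x := r^-1 * x `^ r.
rewrite (@ge0_FTC2_oo _ _ F)//.
- by congr EFin; rewrite /F; field; rewrite gt_eqF.
- move=> x /x0 /is_derive1_powR -/(_ r) dx.
  by apply: (is_derive_eq (is_derive_mull _ dx)); field; rewrite gt_eqF.
- move=> x /x0 /is_derive1_powR -/(_ (r - 1)) [dx _].
  exact: derivable_continuous dx.
- by move=> x _; exact: powR_ge0.
- by apply: cvgM; [exact: cvg_cst|exact: powR_at_right].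
- apply: cvg_at_left_filter; have [dp _] := is_derive1_powR r (le_lt_trans a0 ab).
  by apply: cvgM; [exact: cvg_cst|exact: derivable_continuous dp].
Qed.

Lemma ln_e_div_ge1 T t : 0 < t -> t <= T -> 1 <= ln (expR 1 * T / t).
Proof.
move=> t0 tT; rewrite -[leLHS]expRK ler_ln ?posrE ?expR_gt0//; last first.
  by rewrite divr_gt0// mulr_gt0 ?expR_gt0// (lt_le_trans t0).
by rewrite -mulrA ler_peMr ?expR_ge0// ler_pdivlMr// mul1r.
Qed.

(** For [tau <= t] monotonicity of the logarithm suffices. For [t < tau] put [u = tau / t]: since
    [L >= 1], the logarithm [L + ln u] is at most [L * (1 + ln u)], and [1 + ln u] is absorbed by a
    power of [u]. The exponent [(2 * beta)^-1] is chosen so that raising to [beta] leaves the square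
    root of [tau / t], an integrable singularity. *)
Lemma ln_powR_le beta T tau t : 0 < beta -> 0 < tau -> tau <= T -> 0 < t -> t < T ->
  ln (expR 1 * T / t) `^ beta <=
  (1 + 2 * beta) `^ beta * ln (expR 1 * T / tau) `^ beta * (1 + tau `^ 2^-1 * t `^ (2^-1 - 1)).
Proof.
move=> beta0 tau0 tauT t0 tT.
have T0 : 0 < T by exact: lt_trans tT.
have eT : 0 < expR 1 * T by rewrite mulr_gt0 ?expR_gt0.
set L := ln (_ / tau).
have L1 : 1 <= L by exact: ln_e_div_ge1.
have K1 : 1 <= (1 + 2 * beta) `^ beta.
  by rewrite -[leLHS](powRr0 (1 + 2 * beta)) ler_powR ?ltW//; lra.
have [taut|ttau] := leP tau t.
  apply: (@le_trans _ _ (L `^ beta)).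
    apply: ge0_ler_powR; rewrite ?nnegrE ?(ltW beta0)//.
    - by rewrite (le_trans ler01)// ln_e_div_ge1// ltW.
    - by rewrite (le_trans ler01).
    - rewrite ler_ln ?posrE ?divr_gt0// ler_wpM2l ?(ltW eT)//.
      by rewrite lef_pV2 ?posrE.
  rewrite -mulrA mulrCA ler_peMr ?powR_ge0//.
  rewrite -[leLHS]mul1r ler_pM// lerDl mulr_ge0 ?powR_ge0//.
pose u := tau / t; have u1 : 1 < u by rewrite /u ltr_pdivlMr// mul1r.
have u0 : 0 < u by exact: lt_trans u1.
have -> : ln (expR 1 * T / t) = L + ln u.
  rewrite /L -lnM ?posrE ?divr_gt0//; congr ln; rewrite /u; field.
  by rewrite !gt_eqF.
(* With [v] the power of [u], this follows from [ln u = 2 * beta * ln v], [ln v <= v - 1] and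
   [1 <= v]. *)
have lnu : 1 + ln u <= (1 + 2 * beta) * u `^ (2 * beta)^-1.
  set v := u `^ _.
  have v1 : 1 <= v.
    by rewrite -[leLHS](powRr0 u) /v ler_powR ?ltW// invr_gt0 mulr_gt0.
  have -> : ln u = 2 * beta * ln v by rewrite /v ln_powR; field; rewrite gt_eqF.
  have lnv : ln v <= v - 1.
    rewrite lerBrDl; have := expR_ge1Dx (ln v); rewrite lnK// posrE.
    exact: lt_le_trans v1.
  have : 2 * beta * ln v <= 2 * beta * (v - 1) by rewrite ler_wpM2l// mulr_ge0 ?ltW.
  by lra.
have lnu0 : 0 <= ln u by rewrite ln_ge0 ?ltW.
apply: (@le_trans _ _ ((L * ((1 + 2 * beta) * u `^ (2 * beta)^-1)) `^ beta)).
  apply: ge0_ler_powR; rewrite ?nnegrE ?(ltW beta0)//.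
  - by rewrite addr_ge0// (le_trans ler01).
  - by rewrite !mulr_ge0 ?powR_ge0 ?(le_trans ler01 L1)//; lra.
  - apply: (@le_trans _ _ (L * (1 + ln u))); last by rewrite ler_wpM2l// (le_trans ler01).
    by rewrite mulrDr mulr1 lerD2l ler_peMl.
rewrite powRM ?(le_trans ler01 L1) ?mulr_ge0 ?powR_ge0//; last by lra.
rewrite powRM ?powR_ge0//; last by lra.
rewrite -powRrM (_ : (2 * beta)^-1 * beta = 2^-1); last by field; rewrite gt_eqF.
rewrite mulrCA mulrA ler_wpM2l ?mulr_ge0 ?powR_ge0//.
rewrite /u powRM ?invr_ge0 ?ltW//.
have -> : t^-1 `^ 2^-1 = t `^ (2^-1 - 1).
  by rewrite -(powR_inv1 (ltW t0)) -powRrM; congr (_ `^ _); field.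
by rewrite ltrDr.
Qed.

End PowerIntegrals.

(** * The logarithmic weight *)

Section WeightedHoelder.
Context {R : realType}.
Local Notation mu := (@lebesgue_measure R).
Implicit Types (a tau T p q beta m t : R) (f g h w : R -> R).

Lemma Lnorm_restrict (D : set R) f r : 0 < r ->
  (Lnorm mu r%:E (EFin \o (f \_ D)) =
   (\int[mu]_(x in D) (`|f x| `^ r)%:E) `^ r^-1)%E.
Proof.
move=> r0; rewrite unlock; congr (_ `^ _)%E.
rewrite [RHS]integral_mkcond; apply: eq_integral => x _ /=.
rewrite !patchE; case: ifPn => _ //=.
by rewrite normr0 powR0// gt_eqF.
Qed.

Lemma hoelder_set (D : set R) f h p q : measurable D ->
  measurable_fun D f -> measurable_fun D h ->
  0 < p -> 0 < q -> p^-1 + q^-1 = 1 ->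
  (\int[mu]_(x in D) `|f x * h x|%:E <=
   (\int[mu]_(x in D) (`|f x| `^ p)%:E) `^ p^-1 *
   (\int[mu]_(x in D) (`|h x| `^ q)%:E) `^ q^-1)%E.
Proof.
move=> mD mf mh p0 q0 pq; rewrite -!Lnorm_restrict//.
have mfD : measurable_fun setT (f \_ D) by exact/(measurable_restrictT _ mD).
have mhD : measurable_fun setT (h \_ D) by exact/(measurable_restrictT _ mD).
apply: le_trans (hoelder mu mfD mhD p0 q0 pq).
rewrite Lnorm1 [leLHS]integral_mkcond le_eqVlt; apply/orP; left; apply/eqP.
apply: eq_integral => x _ /=; rewrite !patchE; case: ifPn => _ //=.
by rewrite mulr0 normr0.
Qed.

(** Hoelder's inequality for the factorization of [g] into [g * w^(1/p)] and [w^(-1/p)]. *)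
Lemma weighted_hoelder (D : set R) g w p q : measurable D ->
  measurable_fun D g -> measurable_fun D w -> (forall t, D t -> 0 < w t) ->
  0 < p -> 0 < q -> p^-1 + q^-1 = 1 ->
  (\int[mu]_(t in D) `|g t|%:E <=
   (\int[mu]_(t in D) (`|g t| `^ p * w t)%:E) `^ p^-1 *
   (\int[mu]_(t in D) (w t `^ (- (q / p)))%:E) `^ q^-1)%E.
Proof.
move=> mD mg mw w0 p0 q0 pq.
have mwr r : measurable_fun D (fun t => w t `^ r).
  by apply: (@measurableT_comp _ _ _ _ _ _ (@powR R ^~ r)).
have := @hoelder_set D (fun t => g t * w t `^ p^-1) (fun t => w t `^ (- p^-1)) p q
  mD (measurable_funM mg (mwr _)) (mwr _) p0 q0 pq.
congr (_ <= _ `^ _ * _ `^ _)%E; apply: eq_integral => t /set_mem /w0 wt0; congr EFin.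
- by rewrite -mulrA powRN mulfV ?mulr1// gt_eqF// powR_gt0.
- rewrite normrM powRM// (ger0_norm (powR_ge0 _ _)) -powRrM mulVf ?gt_eqF//.
  by rewrite powRr1// ltW.
- by rewrite (ger0_norm (powR_ge0 _ _)) -powRrM; congr (_ `^ _); ring.
Qed.

Lemma log_weight_gt0 T m t : 0 < t -> t < T -> 0 < log_weight T m t.
Proof.
by move=> t0 tT; rewrite powR_gt0// (lt_le_trans ltr01)// ln_e_div_ge1// ltW.
Qed.

Lemma measurable_ln_powR T r : measurable_fun `]0, T[ (fun t => ln (expR 1 * T / t) `^ r).
Proof.
apply: (@measurableT_comp _ _ _ _ _ _ (@powR R ^~ r)) => //.
apply: (@measurableT_comp _ _ _ _ _ _ (@ln R)) => //.
apply: measurable_funM => //; apply: continuous_oo_measurable_fun => t.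
rewrite in_itv/= => /andP[t0 _]; apply: (@inv_continuous _ t).
by rewrite gt_eqF.
Qed.

(** Integrating [ln_powR_le], the constant term gives [tau] and the singular one
    [2 * sqrt tau * (sqrt (a + tau) - sqrt a)], at most [2 * tau] by subadditivity of the square
    root. Hence the factor 3, uniformly in [a]. *)
Lemma integral_ln_powR_le beta : 0 < beta -> exists2 K : R, 0 < K &
  forall a tau T, 0 <= a -> 0 < tau -> a + tau <= T ->
  (\int[mu]_(t in `]a, (a + tau)%R[) (ln (expR 1 * T / t) `^ beta)%:E <=
   (K * tau * ln (expR 1 * T / tau) `^ beta)%:E)%E.
Proof.
move=> beta0; exists (3 * (1 + 2 * beta) `^ beta).
  by rewrite mulr_gt0// powR_gt0//; lra.
move=> a tau T a0 tau0 atT.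
set K := _ `^ beta; set L := ln (_ / tau) `^ beta.
have K0 : 0 <= K by exact: powR_ge0.
have L0 : 0 <= L by exact: powR_ge0.
have aat : a < a + tau by rewrite ltrDl.
have itv0 t : `]a, (a + tau)[%classic t -> 0 < t /\ t < T.
  by rewrite /= in_itv/= => /andP[at_ ta]; split; lra.
have mpow : measurable_fun `]a, (a + tau)[ (fun t => t `^ (2^-1 - 1)).
  by apply: measurable_funTS; exact: (@measurable_powR R (2^-1 - 1)).
apply: (@le_trans _ _ (\int[mu]_(t in `]a, (a + tau)%R[)
    (K * L * (1 + tau `^ 2^-1 * t `^ (2^-1 - 1)))%:E)%E).
  apply: ge0_le_integral => //.
  - by move=> t _; rewrite lee_fin powR_ge0.
  - apply/measurable_EFinP; apply: (measurable_funS _ _ (@measurable_ln_powR T beta)) => //.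
    by move=> t /itv0; rewrite /= in_itv/= => -[-> ->].
  - apply/measurable_EFinP; apply: measurable_funM => //.
    by apply: measurable_funD => //; exact: measurable_funM.
  - move=> t /itv0[t0 tT]; rewrite lee_fin; apply: ln_powR_le => //; lra.
set KL := K * L; have KL0 : 0 <= KL by exact: mulr_ge0.
rewrite -[leLHS]/(\int[mu]_(t in `]a, (a + tau)%R[)
  (KL%:E * (1%:E + (tau `^ 2^-1)%:E * (t `^ (2^-1 - 1))%:E)))%E.
rewrite ge0_integralZl//; last 2 first.
- apply/measurable_EFinP; apply: measurable_funD => //; exact: measurable_funM.
- by move=> t _; rewrite lee_fin addr_ge0// mulr_ge0 ?powR_ge0.
rewrite ge0_integralD//; last 2 first.
- by move=> t _; rewrite lee_fin mulr_ge0 ?powR_ge0.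
- by apply/measurable_EFinP; exact: measurable_funM.
rewrite ge0_integralZl//; last 3 first.
- exact/measurable_EFinP.
- by move=> t _; rewrite lee_fin powR_ge0.
- by rewrite lee_fin powR_ge0.
rewrite integral_cst//= mul1e lebesgue_measure_itv/= lte_fin aat.
rewrite integral_powR ?invr_gt0// -!EFinM lee_fin.
rewrite !powR12_sqrt ?addr_ge0 ?(ltW tau0)//.
have sq : Num.sqrt (a + tau) - Num.sqrt a <= Num.sqrt tau.
  rewrite lerBlDl -ler_sqr ?nnegrE ?addr_ge0 ?sqrtr_ge0//.
  rewrite sqr_sqrtr ?addr_ge0 ?(ltW tau0)// sqrrD !sqr_sqrtr ?(ltW tau0)//.
  by rewrite lerD2r lerDl mulrn_wge0// mulr_ge0 ?sqrtr_ge0.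
have tt : Num.sqrt tau * Num.sqrt tau = tau by rewrite -expr2 sqr_sqrtr// ltW.
have : Num.sqrt tau * (Num.sqrt (a + tau) - Num.sqrt a) <= tau.
  by rewrite -[leRHS]tt ler_wpM2l ?sqrtr_ge0.
set s := Num.sqrt tau * _ => s_le.
rewrite (_ : 3 * K * tau * L = KL * (3 * tau)); last by rewrite /KL; ring.
rewrite ler_wpM2l//.
rewrite invrK mulrA -/s; lra.
Qed.

End WeightedHoelder.

(** * Oscillation of the derivative on a cell in terms of the Sobolev norm *)

Section SobolevIncrement.
Context {R : realType}.
Local Notation mu := (@lebesgue_measure R).
Implicit Types (a b tau T p q m t : R) (f g y dy : R -> R).

(** With [q] conjugate to [p], the dual factor integrates [ln (e T / t)] to the power [m * q / p].
    Its bound is linear in [tau], and the [q]-th root yields the powers [1 - p^-1] of [tau] and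
    [m / p] of the logarithm. *)
Lemma log_weight_integral_le p T m : 1 < p -> 0 < m -> exists2 K : R, 0 < K &
  forall g a tau, 0 <= a -> 0 < tau -> a + tau <= T -> measurable_fun `]0, T[ g ->
  (\int[mu]_(t in `]a, (a + tau)%R[) `|g t|%:E <=
   (\int[mu]_(t in `]0%R, T[) (`|g t| `^ p * log_weight T m t)%:E) `^ p^-1 *
   (K * tau `^ (1 - p^-1) * ln (expR 1 * T / tau) `^ (m / p))%:E)%E.
Proof.
move=> p1 m0; have p0 : 0 < p by exact: lt_trans p1.
have pV1 : p^-1 < 1 by rewrite invf_lt1.
have [q q0 qV] : exists2 q : R, 0 < q & q^-1 = 1 - p^-1.
  by exists (1 - p^-1)^-1; rewrite ?invrK// invr_gt0 subr_gt0.
have [K K0 HK] := @integral_ln_powR_le R (m * q / p) (divr_gt0 (mulr_gt0 m0 q0) p0).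
exists (K `^ q^-1); first exact: powR_gt0.
move=> g a tau a0 tau0 atT mg.
have itv0 t : `]a, (a + tau)[%classic t -> 0 < t /\ t < T.
  by rewrite /= in_itv/= => /andP[at_ ta]; split; lra.
have sub : `]a, (a + tau)[ `<=` `]0, T[.
  by move=> t /itv0; rewrite /= in_itv/= => -[-> ->].
have mw : measurable_fun `]0, T[ (log_weight T m) by exact: measurable_ln_powR.
apply: (le_trans (@weighted_hoelder _ _ g (log_weight T m) p q _ _ _ _ p0 q0 _)) => //.
- exact: measurable_funS mg.
- exact: measurable_funS mw.
- by move=> t /itv0[t0 tT]; exact: log_weight_gt0.
- by rewrite qV addrC subrK.
apply: lee_pmul; [exact: poweR_ge0|exact: poweR_ge0| |].
  apply: gt0_ler_poweR; rewrite ?invr_ge0 ?(ltW p0)//.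
  - rewrite in_itv/= leey andbT integral_ge0// => t /itv0[t0 tT].
    by rewrite lee_fin mulr_ge0 ?powR_ge0.
  - rewrite in_itv/= leey andbT integral_ge0// => t _.
    by rewrite lee_fin mulr_ge0 ?powR_ge0.
  - apply: ge0_subset_integral => //.
      apply/measurable_EFinP; apply: measurable_funM => //.
      apply: (@measurableT_comp _ _ _ _ _ _ (@powR R ^~ p)) => //.
      exact: measurableT_comp.
    by move=> t _; rewrite lee_fin mulr_ge0 ?powR_ge0.
have -> : (\int[mu]_(t in `]a, (a + tau)%R[) (log_weight T m t `^ (- (q / p)))%:E =
    \int[mu]_(t in `]a, (a + tau)%R[) (ln (expR 1 * T / t) `^ (m * q / p))%:E)%E.
  apply: eq_integral => t _; rewrite /log_weight -powRrM; congr (_ `^ _)%:E.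
  by rewrite mulrNN mulrA.
rewrite -qV; apply: (@le_trans _ _ ((K * tau * ln (expR 1 * T / tau) `^ (m * q / p))%:E `^ q^-1)%E).
  apply: gt0_ler_poweR; rewrite ?invr_ge0 ?(ltW q0)//.
  - rewrite in_itv/= leey andbT integral_ge0// => t _.
    by rewrite lee_fin powR_ge0.
  - by rewrite in_itv/= leey andbT lee_fin !mulr_ge0 ?powR_ge0 ?ltW.
  - exact: HK.
rewrite poweR_EFin lee_fin !powRM ?mulr_ge0 ?powR_ge0 ?(ltW K0) ?(ltW tau0)//.
rewrite -powRrM (_ : m * q / p * q^-1 = m / p)//; last by field; rewrite !gt_eqF.
Qed.

(** [Sobolev_norm] passes through [Rintegral], which would turn an infinite integral into 0; the
    finiteness of the three summands is therefore established first, and only then does monotonicity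
    of the integral apply. *)
Lemma Sobolev_norm_ge T (w : R -> R) p y (k : nat) : 0 < p ->
  measurable_fun `]0, T[ w -> (forall t, 0 <= w t) -> weighted_Sobolev T w 2 p y -> (k <= 2)%N ->
  ((\int[mu]_(t in `]0%R, T[) (`|weak_derivative T k y t| `^ p * w t)%:E) `^ p^-1 <=
  (Sobolev_norm T w 2 p y)%:E)%E.
Proof.
move=> p0 mw w0 Wy k2.
pose G (j : nat) t := `|weak_derivative T j y t| `^ p * w t.
have G0 j t : 0 <= G j t by rewrite mulr_ge0 ?powR_ge0.
have mG j : (j <= 2)%N -> measurable_fun `]0, T[ (G j).
  move=> /Wy[_ [mf _]]; apply: measurable_funM => //.
  apply: (@measurableT_comp _ _ _ _ _ _ (@powR R ^~ p)) => //.
  exact: measurableT_comp.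
have finG j : (j <= 2)%N -> (\int[mu]_(t in `]0%R, T[) (G j t)%:E < +oo)%E.
  by move=> /Wy[_ [_]].
pose S t := G 0%N t + (G 1%N t + G 2%N t).
have SE t : (\sum_(0 <= k < 3) `|weak_derivative T k y t| `^ p) * w t = S t.
  by rewrite !big_nat_recl// big_nil addr0 !mulrDl.
have mS : measurable_fun `]0, T[ S.
  by apply: measurable_funD; [exact: mG|apply: measurable_funD; exact: mG].
have finS : (\int[mu]_(t in `]0%R, T[) (S t)%:E < +oo)%E.
  rewrite -[ltLHS]/(\int[mu]_(t in `]0%R, T[) ((G 0%N t)%:E + ((G 1%N t)%:E + (G 2%N t)%:E)))%E.
  have G0e j t : (0 <= (G j t)%:E)%E by rewrite lee_fin.
  have mGe j : (j <= 2)%N -> measurable_fun `]0, T[ (EFin \o G j).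
    by move=> j2; apply/measurable_EFinP; exact: mG.
  rewrite !ge0_integralD//;
    try solve [exact: mGe | by move=> t _; rewrite adde_ge0
               | by apply: emeasurable_funD; exact: mGe].
  by do 2 (apply: lte_add_pinfty; first exact: finG); exact: finG.
rewrite /Sobolev_norm -poweR_EFin.
have -> : \int[mu]_(t in `]0, T[) ((\sum_(0 <= k < 3) `|weak_derivative T k y t| `^ p) * w t) =
    \int[mu]_(t in `]0, T[) S t by apply: eq_Rintegral => t _.
rewrite /Rintegral fineK; last first.
  rewrite ge0_fin_numE// integral_ge0// => t _.
  by rewrite lee_fin /S !addr_ge0.
apply: gt0_ler_poweR; rewrite ?invr_ge0 ?(ltW p0)//.
- by rewrite in_itv/= leey andbT integral_ge0// => t _; rewrite lee_fin G0.
- by rewrite in_itv/= leey andbT integral_ge0// => t _; rewrite lee_fin /S !addr_ge0.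
- apply: ge0_le_integral => //.
  + by move=> t _; rewrite lee_fin G0.
  + by apply/measurable_EFinP; exact: mG.
  + exact/measurable_EFinP.
  + move=> t _; rewrite lee_fin -/(G k t) /S.
    case: k k2 => [|[|[|]]]// _; first by rewrite lerDl addr_ge0.
      by rewrite addrCA lerDl addr_ge0.
    by rewrite addrA lerDr addr_ge0.
Qed.

Lemma Sobolev_increment p T m : 1 < p -> 0 < m -> exists2 K : R, 0 < K &
  forall y dy a tau s r, weighted_Sobolev T (log_weight T m) 2 p y ->
  {in `]0, T[, forall x, derivable y x 1} -> {in `]0, T[, continuous dy} ->
  {in `]0, T[, derive1 y =1 dy} ->
  0 <= a -> 0 < tau -> a + tau <= T ->
  s \in `]a, (a + tau)[ -> r \in `]a, (a + tau)[ ->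
  `|dy s - dy r| <= K * tau `^ (1 - p^-1) * ln (expR 1 * T / tau) `^ (m / p) *
    Sobolev_norm T (log_weight T m) 2 p y.
Proof.
move=> p1 m0; have [K K0 HK] := log_weight_integral_le T p1 m0; exists K => //.
move=> y dy a tau s r Wy y1 cdy ydy a0 tau0 atT.
have p0 : 0 < p by exact: lt_trans p1.
(* The bound is symmetric in [s] and [r], and trivial when they coincide. *)
wlog rs : s r / r < s => [wl sI rI|].
  have [rs|sr|->] := ltgtP r s; first exact: wl.
    by rewrite distrC; exact: wl.
  by rewrite subrr normr0 !mulr_ge0 ?powR_ge0 ?ltW.
rewrite !in_itv/= => /andP[as_ sa] /andP[ar ra].
have [weak [mg _]] := Wy 2%N (leqnn _).
rewrite -lee_fin.
apply: (le_trans (weak_derivative2_increment _ rs _ y1 cdy ydy weak)); [lra|lra|].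
apply: (@le_trans _ _ (\int[mu]_(t in `]a, (a + tau)%R[) `|weak_derivative T 2 y t|%:E)%E).
  apply: ge0_subset_integral => //.
  - apply/measurable_EFinP; apply: measurableT_comp => //.
    apply: (measurable_funS _ _ mg) => //.
    by move=> x; rewrite /= !in_itv/=; lra.
  - by move=> x /=; rewrite !in_itv/=; lra.
apply: (le_trans (HK _ _ _ a0 tau0 atT mg)).
rewrite muleC [leRHS]EFinM lee_pmul ?poweR_ge0 ?lee_fin ?mulr_ge0 ?powR_ge0 ?(ltW K0)//.
by apply: Sobolev_norm_ge => //; [exact: measurable_ln_powR|move=> t; exact: powR_ge0].
Qed.

End SobolevIncrement.

(** * The Gamma function *)

Section GammaRecurrence.
Context {R : realType}.
Local Notation mu := (@lebesgue_measure R).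
Implicit Types (r t : R).

Definition gamma_integrand r t : R := t `^ r * expR (- t).

Lemma gamma_integrand_ge0 r t : 0 <= gamma_integrand r t.
Proof. by rewrite mulr_ge0 ?powR_ge0 ?expR_ge0. Qed.

Lemma measurable_gamma_integrand (D : set R) r : measurable_fun D (gamma_integrand r).
Proof.
apply: measurable_funTS; apply: measurable_funM; first exact: measurable_powR.
by apply: measurableT_comp => //; exact: measurable_expR.
Qed.

Lemma is_derive_gamma_integrand r t : 0 < t ->
  is_derive t 1 (gamma_integrand r) (r * gamma_integrand (r - 1) t - gamma_integrand r t).
Proof.
move=> t0; have dp := is_derive1_powR r t0.
have de : is_derive t 1 (fun t => expR (- t)) (expR (- t) * - 1).
  exact: (@is_derive1_comp _ expR -%R).
have := is_deriveM dp de; rewrite /GRing.scale/= => dM.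
by apply: (is_derive_eq dM); rewrite /gamma_integrand; ring.
Qed.

(** This is [flat_le] at [t^-1], with the real exponent [r] rounded up to the integer
    [Num.bound r]. *)
Lemma gamma_integrand_le r t : 0 <= r -> 1 <= t ->
  gamma_integrand r t <= (Num.bound r).+1`!%:R / t.
Proof.
move=> r0 t1; have t0 : 0 < t by exact: lt_le_trans t1.
have := flat_le (Num.bound r) t^-1; rewrite /flat invr_gt0 t0 invrK.
rewrite gtr0_norm ?invr_gt0//; apply: le_trans.
rewrite ler_wpM2r ?expR_ge0// -powR_mulrn ?(ltW t0)// ler_powR//.
by rewrite ltW// archi_boundP.
Qed.

(* Both integrals are limits of integrals over compact intervals in the extended
   reals, so their finiteness plays no role. *)
Lemma Gamma_recurrence r : 0 < r -> Gamma (r + 1) = r * Gamma r.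
Proof.
move=> r0.
(* [v] starts at 2 because [u 0] is already 1. Also [(v n)^-1 <= u n], which is used for the
   boundary term at [v n]. *)
pose u (n : nat) : R := harmonic n; pose v (n : nat) : R := n.+2%:R.
have u0 n : 0 < u n by exact: harmonic_gt0.
have uv n : u n < v n.
  rewrite (le_lt_trans (harmonic_nonincreasing (leq0n n)))//=.
  by rewrite invr1 ltr1n.
have cu : u n @[n --> \oo] --> (0 : R) by exact: cvg_harmonic.
have sub n : {subset `[u n, v n]%R <= `]0, +oo[%R}.
  by move=> x; rewrite !in_itv/= andbT => /andP[/(lt_le_trans (u0 n))].
have exh s : (\int[mu]_(t in `[u n, v n]) (gamma_integrand s t)%:E @[n --> \oo] -->
    \int[mu]_(t in `]0%R, +oo[) (gamma_integrand s t)%:E)%E.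
  apply: ge0_integral_exhaustion => //.
  - by move=> m n mn; rewrite harmonic_nonincreasing// /v ler_nat !ltnS.
  - move=> x x0'; have x0 : 0 < x by move: x0'; rewrite /= in_itv/= andbT.
    near=> n; apply/andP; split.
      by apply: ltW; near: n; exact: (cvgr_lt _ cu).
    near: n; exists (Num.bound x) => // n /= xn.
    rewrite (le_trans (ltW (archi_boundP (ltW x0))))// /v ler_nat.
    by rewrite (leq_trans xn)// -addn2 leq_addr.
  - exact: measurable_gamma_integrand.
  - by move=> x _; exact: gamma_integrand_ge0.
have cg s n : {within `[u n, v n], continuous (gamma_integrand s)}.
  apply: derivable_within_continuous => x /sub; rewrite in_itv/= andbT => x0.
  by have [] := is_derive_gamma_integrand s x0.
have ig s n : mu.-integrable `[u n, v n] (EFin \o gamma_integrand s).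
  by apply: continuous_compact_integrable => //; exact: segment_compact.
pose I s n := \int[mu]_(t in `[u n, v n]) gamma_integrand s t.
have IE s n : (\int[mu]_(t in `[u n, v n]) (gamma_integrand s t)%:E)%E = (I s n)%:E.
  by rewrite /I /Rintegral fineK//; exact: integrable_fin_num (ig s n).
pose e n := gamma_integrand r (u n) - gamma_integrand r (v n).
(* Integrating the derivative of [gamma_integrand r] over the segment gives integration by parts,
   with boundary term [e n]. *)
have ibp n : I r n = r * I (r - 1) n + e n.
  have dg x : 0 < x -> derivable (gamma_integrand r) x 1.
    by move=> x0; have [] := is_derive_gamma_integrand r x0.
  have : \int[mu]_(t in `[u n, v n])
      (r * gamma_integrand (r - 1) t - gamma_integrand r t) = - e n.
    rewrite /Rintegral (@continuous_FTC2 _ _ (gamma_integrand r))//.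
    - by rewrite -EFinB /e opprB.
    - apply: within_continuousB => //; apply: within_continuousM => //.
      exact: within_continuous_cst.
    - have dg' x : 0 < x -> {for x, continuous (gamma_integrand r)}.
        by move=> /dg /derivable_continuous.
      split => [x xuv||].
      + have := sub n _ (subset_itv_oo_cc xuv).
        by rewrite in_itv/= andbT => /dg.
      + by apply: cvg_at_right_filter; exact: dg' (u0 n).
      + by apply: cvg_at_left_filter; exact: dg' (lt_trans (u0 n) (uv n)).
    - move=> x xuv; have := sub n _ (subset_itv_oo_cc xuv).
      rewrite in_itv/= andbT => x0; rewrite derive1E.
      by have [_ ->] := is_derive_gamma_integrand r x0.
  rewrite RintegralB//; last first.
    apply: continuous_compact_integrable; first exact: segment_compact.
    by apply: within_continuousM => //; exact: within_continuous_cst.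
  rewrite RintegralZl// -/(I (r - 1) n) -/(I r n); lra.
have ce : e n @[n --> \oo] --> (0 : R).
  rewrite -[X in _ --> X]subr0; apply: cvgB.
    apply: (@squeeze_cvgr _ _ _ _ (cst 0) (fun n => u n `^ r)).
    - apply: nearW => n; rewrite gamma_integrand_ge0/= /gamma_integrand.
      by rewrite ler_piMr ?powR_ge0// expR_le1 oppr_le0 ltW.
    - exact: cvg_cst.
    - have /cvg_at_rightP : x `^ r @[x --> 0^'+] --> (0 : R) by exact: powR_cvg0.
      by apply; split.
  apply: (@squeeze_cvgr _ _ _ _ (cst 0) (fun n => (Num.bound r).+1`!%:R * u n)).
  - apply: nearW => n; rewrite gamma_integrand_ge0/=.
    apply: (le_trans (gamma_integrand_le (ltW r0) _)); first by rewrite ler1n.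
    by rewrite ler_wpM2l// lef_pV2 ?posrE// ler_nat.
  - exact: cvg_cst.
  - by rewrite -[X in _ --> X](mulr0 ((Num.bound r).+1`!%:R : R)); exact: cvgMr.
have lim : (\int[mu]_(t in `]0%R, +oo[) (gamma_integrand r t)%:E =
    r%:E * \int[mu]_(t in `]0%R, +oo[) (gamma_integrand (r - 1) t)%:E)%E.
  have IS : (fun n => \int[mu]_(t in `[u n, v n]) (gamma_integrand r t)%:E)%E =
      (fun n => r%:E * \int[mu]_(t in `[u n, v n]) (gamma_integrand (r - 1) t)%:E + (e n)%:E)%E.
    by apply/funext => n; rewrite !IE ibp EFinD EFinM.
  have /cvgeD : (r%:E * \int[mu]_(t in `[u n, v n]) (gamma_integrand (r - 1) t)%:E @[n --> \oo] -->
      r%:E * \int[mu]_(t in `]0%R, +oo[) (gamma_integrand (r - 1) t)%:E)%E.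
    by apply: cvgeZl => //; exact: exh.
  have ceE : (e n)%:E @[n --> \oo] --> (0 : R)%:E by apply: cvg_EFin => //; exact: nearW.
  move=> /(_ (EFin \o e) _ _ ceE); rewrite fin_num_adde_defl// adde0 => /(_ isT) limr.
  by apply: (cvg_unique _ (exh r)) => //; rewrite IS.
rewrite /Gamma addrK /Rintegral -[X in fine X]/(\int[mu]_(t in `]0%R, +oo[) (gamma_integrand r t)%:E)%E.
rewrite lim -/(gamma_integrand (r - 1)).
(* Multiplication by [r > 0] preserves an infinite value, and [fine] then sends both sides to 0. *)
case: (integral _ _ _) => [x//||]; first by rewrite gt0_muley ?lte_fin//= mulr0.
by rewrite gt0_muleNy ?lte_fin//= mulr0.
Unshelve. all: by end_near. Qed.

End GammaRecurrence.

(** * Error of the L1 scheme *)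

Section CellError.
Context {R : realType}.
Local Notation mu := (@lebesgue_measure R).
Implicit Types (a b c alpha s r M : R) (y dy : R -> R).

Lemma measurable_powR_subr (D : set R) c r : measurable_fun D (fun s => (c - s) `^ r).
Proof.
apply: measurable_funTS.
apply: (@measurableT_comp _ _ _ _ _ _ (@powR R ^~ r)); first exact: measurable_powR.
exact: measurable_funB.
Qed.

Lemma Rintegral_powR_subr a b c alpha : a < b -> b <= c -> alpha < 1 ->
  \int[mu]_(s in `]a, b[) ((c - s) `^ (- alpha)) =
  ((c - a) `^ (1 - alpha) - (c - b) `^ (1 - alpha)) / (1 - alpha).
Proof.
move=> ab bc al1; have := @integral_powR_subr R a b c (1 - alpha) ab bc.
rewrite (_ : 1 - alpha - 1 = - alpha); last by ring.
by rewrite subr_gt0 /Rintegral => ->.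
Qed.

Lemma integrable_powR_subr a b c alpha : a < b -> b <= c -> alpha < 1 ->
  mu.-integrable `]a, b[ (EFin \o (fun s => (c - s) `^ (- alpha))).
Proof.
move=> ab bc al1; apply/integrableP; split.
  by apply/measurable_EFinP; exact: measurable_powR_subr.
under eq_integral do rewrite /= ger0_norm ?powR_ge0//.
have := @integral_powR_subr R a b c (1 - alpha) ab bc.
rewrite (_ : 1 - alpha - 1 = - alpha); last by ring.
by rewrite subr_gt0 => -> //; exact: ltry.
Qed.

(** The product is dominated by the maximum of the absolute value of [dy] on the closed cell times
    the integrable kernel. *)
Lemma integrable_continuousM_powR_subr a b c alpha dy : a < b -> b <= c -> alpha < 1 ->
  {within `[a, b], continuous dy} ->
  mu.-integrable `]a, b[ (EFin \o (fun s => dy s * (c - s) `^ (- alpha))).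
Proof.
move=> ab bc al1 cdy.
have [m _ Bdy] := @EVT_max _ (fun s => `|dy s|) a b (ltW ab) (within_continuous_norm cdy).
have ik := integrable_powR_subr ab bc al1.
have mdy : measurable_fun `]a, b[ dy.
  by apply: continuous_oo_measurable_fun => x; exact: within_continuous_continuous.
apply: (@le_integrable _ _ _ mu _ _ _
    (fun s => `|dy m|%:E * ((c - s) `^ (- alpha))%:E)%E) => //.
- by apply/measurable_EFinP; apply: measurable_funM => //; exact: measurable_powR_subr.
- move=> s sab; rewrite /= lee_fin !normrM normr_id ler_wpM2r//.
  by apply: Bdy; exact: subset_itv_oo_cc.
- exact: integrableZl.
Qed.

Lemma Rintegral_itv_oo_cc a b dy : {within `[a, b], continuous dy} ->
  \int[mu]_(s in `]a, b[) dy s = \int[mu]_(s in `[a, b]) dy s.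
Proof.
move=> cdy.
have icc : mu.-integrable `[a, b] (EFin \o dy).
  by apply: continuous_compact_integrable => //; exact: segment_compact.
rewrite Rintegral_itv_bndo_bndc; last first.
  by apply: integrableS icc => //; exact: subset_itv_oo_cc.
rewrite Rintegral_itv_obnd_cbnd//.
by apply: integrableS icc => //; exact: subset_itv_oc_cc.
Qed.

(* [dy] minus the mean slope has integral [0], so the kernel may be replaced by
   its excess over its minimum [(c - a) `^ (- alpha)] on the cell. *)
Lemma cell_error a b c alpha y dy M : a < b -> b <= c -> 0 < alpha < 1 ->
  {within `[a, b], continuous dy} -> derivable_oo_LRcontinuous y a b ->
  {in `]a, b[, derive1 y =1 dy} ->
  {in `]a, b[ &, forall s r, `|dy s - dy r| <= M} ->
  `|\int[mu]_(s in `]a, b[) (dy s * (c - s) `^ (- alpha)) -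
    (y b - y a) / (b - a) * \int[mu]_(s in `]a, b[) ((c - s) `^ (- alpha))|
  <= M * (\int[mu]_(s in `]a, b[) ((c - s) `^ (- alpha)) - (b - a) * (c - a) `^ (- alpha)).
Proof.
move=> ab bc /andP[al0 al1] cdy y1 ydy osc.
have ba0 : 0 < b - a by rewrite subr_gt0.
have ik := integrable_powR_subr ab bc al1.
have idk := integrable_continuousM_powR_subr ab bc al1 cdy.
set k := fun s => (c - s) `^ (- alpha).
set A := (y b - y a) / (b - a).
(* The mean slope is a value of [dy] inside the cell, so the oscillation bound [M] also controls
   [dy] minus the slope. *)
have [xi xiab dyxi] : exists2 xi, xi \in `]a, b[ & y b - y a = dy xi * (b - a).
  apply: MVT => //; last exact: derivable_oo_LRcontinuous_within y1.
  move=> x xab; rewrite -ydy// derive1E; apply/derivableP.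
  by case: y1 => + _ _; apply.
have Axi : A = dy xi by rewrite /A dyxi mulfK// gt_eqF.
have kge s : s \in `]a, b[ -> k a <= k s.
  rewrite in_itv/= => /andP[as_ sb]; rewrite /k !powRN lef_pV2 ?posrE ?powR_gt0//; try lra.
  by apply: ge0_ler_powR; rewrite ?nnegrE//; lra.
have Idy : \int[mu]_(s in `]a, b[) dy s = y b - y a.
  by rewrite Rintegral_itv_oo_cc// /Rintegral (@continuous_FTC2 _ _ y)// -EFinB.
have mIab : fine (mu `]a, b[%classic) = b - a.
  by rewrite lebesgue_measure_itv/= lte_fin ab.
have icst (e : R) : mu.-integrable `]a, b[ (EFin \o (fun=> e)).
  apply: (@integrableS _ _ _ mu `[a, b]) => //; first exact: subset_itv_oo_cc.
  apply: continuous_compact_integrable; first exact: segment_compact.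
  exact: within_continuous_cst.
have idy : mu.-integrable `]a, b[ (EFin \o dy).
  apply: (@integrableS _ _ _ mu `[a, b]) => //; first exact: subset_itv_oo_cc.
  by apply: continuous_compact_integrable => //; exact: segment_compact.
have iB (f g : R -> R) : mu.-integrable `]a, b[ (EFin \o f) ->
    mu.-integrable `]a, b[ (EFin \o g) ->
    mu.-integrable `]a, b[ (EFin \o (fun s => f s - g s)).
  by move=> fi gi; exact: (@integrableB _ _ _ mu _ _ _ _ fi gi).
have iZ (e : R) (f : R -> R) : mu.-integrable `]a, b[ (EFin \o f) ->
    mu.-integrable `]a, b[ (EFin \o (fun s => e * f s)).
  by move=> fi; exact: (@integrableZl _ _ _ mu _ _ e _ fi).
have -> : \int[mu]_(s in `]a, b[) (dy s * k s) - A * \int[mu]_(s in `]a, b[) k s =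
    \int[mu]_(s in `]a, b[) ((dy s * k s - A * k s) - (k a * dy s - k a * A)).
  rewrite !RintegralB//; try by [exact: iZ|apply: iB; [|exact: iZ]|apply: iB; [exact: iZ|]].
  rewrite !RintegralZl// Rintegral_cst// [X in fine X](_ : _ = mu `]a, b[%classic)// mIab Idy.
  by rewrite mulVf ?gt_eqF// mulr1 subrr subr0.
have iD : mu.-integrable `]a, b[ (EFin \o (fun s => (dy s * k s - A * k s) - (k a * dy s - k a * A))).
  by apply: (iB (fun s => dy s * k s - A * k s) (fun s => k a * dy s - k a * A));
    apply: iB => //; exact: iZ.
apply: (le_trans (le_normr_Rintegral _ iD)) => //.
have -> : M * (\int[mu]_(s in `]a, b[) k s - (b - a) * k a) =
    \int[mu]_(s in `]a, b[) (M * (k s - k a)).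
  rewrite RintegralZl//; last exact: iB.
  rewrite RintegralB// Rintegral_cst// [X in fine X](_ : _ = mu `]a, b[%classic)// mIab.
  by rewrite [k a * _]mulrC.
apply: le_Rintegral => //.
- exact: (integrable_norm iD).
- by apply: iZ; exact: iB.
- move=> s sab; have -> : dy s * k s - A * k s - (k a * dy s - k a * A) =
    (dy s - A) * (k s - k a) by ring.
  rewrite normrM [`|k s - k a|]ger0_norm ?subr_ge0 ?kge//.
  by rewrite ler_wpM2r ?subr_ge0 ?kge// Axi; exact: osc.
Qed.

End CellError.

(** * Summation of the cell errors *)

Section SchemeError.
Context {R : realType}.
Local Notation mu := (@lebesgue_measure R).
Implicit Types (a b c alpha tau s r M : R) (f y dy : R -> R) (u Y : R^nat).

Lemma derivable_oo_LRcontinuousW y a b a' b' : derivable_oo_LRcontinuous y a b ->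
  a <= a' -> a' < b' -> b' <= b -> derivable_oo_LRcontinuous y a' b'.
Proof.
move=> y1 aa' ab' bb'.
have cy : {within `[a', b'], continuous y}.
  apply: continuous_subspaceW (derivable_oo_LRcontinuous_within y1).
  by apply: subset_itvScc; rewrite bnd_simp.
have [_ ca cb] := (continuous_within_itvP _ ab').1 cy.
split => // x xab; case: y1 => + _ _; apply.
by apply: subset_itvSoo xab; rewrite bnd_simp.
Qed.

Lemma Rintegral_partition u f m : (forall i, u i < u i.+1) ->
  mu.-integrable `]u 0%N, u m[ (EFin \o f) ->
  \int[mu]_(s in `]u 0%N, u m[) f s =
  \sum_(0 <= i < m) \int[mu]_(s in `]u i, u i.+1[) f s.
Proof.
move=> uS; have u0 i : u 0%N <= u i.
  by elim: i => // i IHi; exact: (le_trans IHi (ltW (uS i))).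
elim: m => [_|m IHm fi].
  by rewrite big_nil set_itv_ge ?bnd_simp ?ltxx// Rintegral_set0.
have fim : mu.-integrable `]u 0%N, u m[ (EFin \o f).
  by apply: integrableS fi => //; apply: subset_itvl; rewrite bnd_simp ltW.
rewrite big_nat_recr//= -IHm//.
rewrite -(@Rintegral_itvB _ f _ _ (u m) fi) ?bnd_simp//.
by rewrite (Rintegral_itv_bndo_bndc fim) addrC subrK.
Qed.

(** Abel summation, rewriting the scheme in terms of increments over cells; [b 0 = 1] accounts for
    the coefficient 1 of [Y n]. *)
Lemma summation_by_parts (b : R^nat) Y n : (0 < n)%N -> b 0%N = 1 ->
  Y n - b n.-1 * Y 0%N - \sum_(1 <= i < n) (b (n - i - 1)%N - b (n - i)%N) * Y i =
  \sum_(0 <= i < n) b (n - i - 1)%N * (Y i.+1 - Y i).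
Proof.
case: n => // n _ b0; rewrite [n.+1.-1]/=.
under [RHS]eq_bigr do rewrite mulrBr.
rewrite sumrB [X in _ = X - _]big_nat_recr//= subSnn subnn b0 mul1r.
rewrite [X in _ = _ - X]big_ltn// subn0 subn1/=.
under eq_bigr do rewrite mulrBl.
rewrite sumrB [\sum_(1 <= i < n.+1) b (n.+1 - i)%N * Y i]big_add1/=.
have -> : \sum_(0 <= i < n) b (n.+1 - i - 1)%N * Y i.+1 =
    \sum_(0 <= i < n) b (n.+1 - i.+1)%N * Y i.+1.
  by apply: eq_bigr => i _; rewrite -subnDA addn1.
ring.
Qed.

(** The kernel increases towards the singularity, so on every cell but the last the excess is at
    most [tau] times the increment of [k], and these telescope. Their top term cancels the [tau * k]
    subtracted in the last cell, which leaves at most the integral of [k] over the last cell. That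
    cell is treated apart because [k] is singular at its right end. *)
Lemma kernel_cell_sum_le alpha tau n (k := fun s => (n.+1%:R * tau - s) `^ (- alpha)) :
  0 < alpha < 1 -> 0 < tau ->
  \sum_(0 <= i < n.+1) (\int[mu]_(s in `](i%:R * tau), (i.+1%:R * tau)[) k s -
    tau * k (i%:R * tau)) <= tau `^ (1 - alpha) / (1 - alpha).
Proof.
move=> /andP[al0 al1] tau0.
have cell i : i.+1%:R * tau - i%:R * tau = tau by rewrite -natr1; ring.
have lt_cell i : i%:R * tau < i.+1%:R * tau by rewrite ltr_pM2r// ltr_nat.
rewrite big_nat_recr//=.
have : \sum_(0 <= i < n) (\int[mu]_(s in `](i%:R * tau), (i.+1%:R * tau)[) k s -
    tau * k (i%:R * tau)) <= \sum_(0 <= i < n) (tau * k (i.+1%:R * tau) - tau * k (i%:R * tau)).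
  apply: ler_sum_nat => i /andP[_ ni]; rewrite lerD2r//.
  have ilt : i.+1%:R * tau < n.+1%:R * tau by rewrite ltr_pM2r// ltr_nat ltnS.
  apply: (@le_trans _ _ (\int[mu]_(s in `](i%:R * tau), (i.+1%:R * tau)[) k (i.+1%:R * tau))).
    apply: le_Rintegral => //.
    - by apply: integrable_powR_subr => //; exact: ltW.
    - apply: (@integrableS _ _ _ mu `[(i%:R * tau), (i.+1%:R * tau)]) => //.
        exact: subset_itv_oo_cc.
      apply: continuous_compact_integrable; first exact: segment_compact.
      exact: within_continuous_cst.
    - move=> s; rewrite /= in_itv/= => /andP[is_ si]; rewrite /k !powRN.
      have s0 : 0 < n.+1%:R * tau - i.+1%:R * tau by rewrite subr_gt0.
      have s1 : n.+1%:R * tau - i.+1%:R * tau <= n.+1%:R * tau - s by rewrite lerD2l lerN2 ltW.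
      rewrite lef_pV2 ?posrE ?powR_gt0//; last exact: lt_le_trans s1.
      apply: ge0_ler_powR; rewrite ?nnegrE ?(ltW al0) ?(ltW s0)//.
      exact: ltW (lt_le_trans s0 s1).
  rewrite Rintegral_cst//= lebesgue_measure_itv/= lte_fin lt_cell/= cell.
  by rewrite mulrC.
rewrite telescope_sumr// => le_tel.
have tk0 : 0 <= tau * k (0%N%:R * tau) by rewrite mulr_ge0 ?powR_ge0 ?(ltW tau0).
have -> : tau `^ (1 - alpha) / (1 - alpha) =
    \int[mu]_(s in `](n%:R * tau), (n.+1%:R * tau)[) k s.
  rewrite Rintegral_powR_subr// cell subrr powR0 ?subr0//.
  by rewrite gt_eqF// subr_gt0.
apply: (le_trans (lerD le_tel (lexx _))).
by rewrite addrC addrA subrK lerBlDr lerDl.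
Qed.

Lemma L1_scheme_error alpha tau y dy M n : 0 < alpha < 1 -> 0 < tau -> (0 < n)%N ->
  derivable_oo_LRcontinuous y 0 (n%:R * tau) ->
  {within `[0, n%:R * tau], continuous dy} ->
  {in `]0, n%:R * tau[, derive1 y =1 dy} ->
  0 <= M ->
  (forall i, (i < n)%N -> {in `](i%:R * tau), (i.+1%:R * tau)[ &,
    forall s r, `|dy s - dy r| <= M}) ->
  `|Caputo alpha y (n%:R * tau) - L1_scheme alpha tau y n| <=
  `|(Gamma (1 - alpha))^-1| * (M * (tau `^ (1 - alpha) / (1 - alpha))).
Proof.
case: n => // n al01 tau0 _ y1 cdy ydy M0 osc; set c := n.+1%:R * tau.
have /andP[al0 al1] := al01.
have al1' : 0 < 1 - alpha by rewrite subr_gt0.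
have c0 : 0 < c by rewrite mulr_gt0.
have cell i : i.+1%:R * tau - i%:R * tau = tau by rewrite -natr1; ring.
have lt_cell i : i%:R * tau < i.+1%:R * tau by rewrite ltr_pM2r// ltr_nat.
pose k s := (c - s) `^ (- alpha).
pose K (i : nat) := \int[mu]_(s in `](i%:R * tau), (i.+1%:R * tau)[) k s.
pose D (i : nat) := (y (i.+1%:R * tau) - y (i%:R * tau)) / tau.
have CaputoE : Caputo alpha y c = (Gamma (1 - alpha))^-1 *
    \sum_(0 <= i < n.+1) \int[mu]_(s in `](i%:R * tau), (i.+1%:R * tau)[) (dy s * k s).
  rewrite /Caputo; congr (_ * _).
  rewrite -(@Rintegral_partition (fun i => i%:R * tau) (fun s => dy s * k s))//.
    rewrite mul0r; apply: eq_Rintegral => s /set_mem sc.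
    by rewrite ydy// /k powRN.
  by rewrite mul0r; exact: integrable_continuousM_powR_subr.
(* Up to a common factor, the coefficients of the scheme are the integrals of the kernel over the
   cells. *)
have KE i : (i < n.+1)%N -> K i = tau `^ (1 - alpha) * L1_coef alpha (n.+1 - i - 1) / (1 - alpha).
  move=> ni; rewrite /K Rintegral_powR_subr//; last by rewrite ler_pM2r// ler_nat.
  have powE j : (j <= n.+1)%N ->
      (c - j%:R * tau) `^ (1 - alpha) = (n.+1 - j)%:R `^ (1 - alpha) * tau `^ (1 - alpha).
    by move=> jn; rewrite -powRM ?(ltW tau0)// natrB// mulrBl.
  rewrite !powE//; last exact: ltnW.
  rewrite -mulrBl /L1_coef -subnDA addn1 -(subnSK ni).
  by congr (_ / _); exact: mulrC.
have L1E : L1_scheme alpha tau y n.+1 = (Gamma (1 - alpha))^-1 *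
    \sum_(0 <= i < n.+1) D i * K i.
  rewrite /L1_scheme.
  have b0 : L1_coef alpha 0 = 1 :> R.
    by rewrite /L1_coef powR1 powR0 ?subr0// gt_eqF.
  have := @summation_by_parts (L1_coef alpha) (fun i => y (i%:R * tau)) n.+1 isT b0.
  rewrite mul0r => ->.
  rewrite (_ : 2 - alpha = (1 - alpha) + 1); last by ring.
  rewrite Gamma_recurrence// invfM !big_distrr/=; apply: eq_big_nat => i /andP[_ ni].
  rewrite KE// /D powRB ?(gt_eqF tau0) ?implybT// powRr1 ?(ltW tau0)// powRN.
  (* The inverse Gamma value is a factor of both sides and is made opaque for [field]. *)
  move: (Gamma (1 - alpha))^-1 => Gi.
  by field; rewrite !gt_eqF ?powR_gt0.
rewrite CaputoE L1E -mulrBr -sumrB normrM ler_wpM2l//.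
apply: (le_trans (ler_norm_sum _ _ _)).
apply: (@le_trans _ _ (\sum_(0 <= i < n.+1) M * (K i - tau * k (i%:R * tau)))); last first.
  by rewrite -big_distrr/= ler_wpM2l// kernel_cell_sum_le.
apply: ler_sum_nat => i /andP[_ ni].
have ic : i.+1%:R * tau <= c by rewrite ler_pM2r// ler_nat.
have i0 : 0 <= i%:R * tau by rewrite mulr_ge0 ?(ltW tau0).
have := @cell_error _ _ _ c alpha y dy M (lt_cell i) ic al01 _ _ _ (osc i ni).
rewrite cell; apply.
- by apply: continuous_subspaceW cdy; apply: subset_itvScc; rewrite bnd_simp.
- exact: derivable_oo_LRcontinuousW y1 i0 (lt_cell i) ic.
- move=> x xi; apply: ydy; apply: subset_itvSoo xi; by rewrite bnd_simp.
Qed.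

End SchemeError.

(** * The oscillation bound inserted into the scheme error *)

Theorem corollary3 (R : realType) (alpha p T mu : R)
    (halpha : 0 < alpha < 1) (hp : 1 < p) (hT : 0 < T) (hmu : 0 < mu) :
  exists2 C : R, 0 < C &
    forall (y : R -> R),
      C1_closed T y ->
      weighted_Sobolev T (log_weight T mu) 2 p y ->
      forall N n : nat, (1 <= N)%N -> (1 <= n <= N)%N ->
      let tau := T / N%:R in
      `|Caputo alpha y (n%:R * tau) - L1_scheme alpha tau y n|
        <= C * tau `^ (2 - alpha - p^-1)
             * ln (expR 1 * T / tau) `^ (mu / p)
             * Sobolev_norm T (log_weight T mu) 2 p y.
Proof.
have [K K0 HK] := Sobolev_increment T hp hmu.
have /andP[al0 al1] := halpha.
have al1' : 0 < 1 - alpha by rewrite subr_gt0.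
pose G := `|(Gamma (1 - alpha))^-1|; have G0 : 0 <= G by exact: normr_ge0.
(* The summand 1 makes the constant strictly positive, since [G] is only known to be nonnegative. *)
exists (G * (K / (1 - alpha)) + 1).
  by rewrite ltr_wpDl// mulr_ge0// divr_ge0 ?ltW.
move=> y [y1 [dy cdy ydy]] Wy N n N1 /andP[n1 nN]; cbv zeta; set tau := T / _.
have N0 : 0 < N%:R :> R by rewrite ltr0n.
have tau0 : 0 < tau by exact: divr_gt0.
have NT : N%:R * tau = T by rewrite mulrC divfK// gt_eqF.
have leT i : (i <= N)%N -> i%:R * tau <= T by move=> iN; rewrite -NT ler_pM2r// ler_nat.
have ntau0 : 0 < n%:R * tau by rewrite mulr_gt0// ltr0n.
set L := ln _ `^ _; set S := Sobolev_norm _ _ _ _ _.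
have L0 : 0 <= L by exact: powR_ge0.
have S0 : 0 <= S by exact: powR_ge0.
(* [M] bounds the oscillation of [dy] on every cell of the grid, independently of the cell. *)
pose M := K * tau `^ (1 - p^-1) * L * S.
have M0 : 0 <= M by rewrite /M !mulr_ge0 ?powR_ge0// ltW.
have dyc : {in `]0, T[, continuous dy}.
  by move=> x xT; exact: within_continuous_continuous hT cdy xT.
have dy1 : {in `]0, T[, forall x, derivable y x 1} by case: y1.
apply: (@le_trans _ _ (G * (M * (tau `^ (1 - alpha) / (1 - alpha))))).
  apply: (@L1_scheme_error _ alpha tau y dy M n) => //.
  - exact: derivable_oo_LRcontinuousW y1 (lexx 0) ntau0 (leT n nN).
  - apply: continuous_subspaceW cdy; apply: subset_itvScc; rewrite bnd_simp//.
    exact: leT.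
  - move=> x xn; apply: ydy; apply: subset_itvSoo xn; rewrite bnd_simp//.
    exact: leT.
  - move=> i ni s r.
    have -> : i.+1%:R * tau = i%:R * tau + tau by rewrite -natr1; ring.
    apply: HK => //; first by rewrite mulr_ge0// ltW.
    rewrite (_ : _ + tau = i.+1%:R * tau); first exact/leT/(leq_trans ni).
    by rewrite -natr1; ring.
(* The order splits into the contribution of the oscillation on a cell and that of the summed kernel
   excess. *)
have -> : tau `^ (2 - alpha - p^-1) = tau `^ (1 - p^-1) * tau `^ (1 - alpha).
  by rewrite -powRD ?(gt_eqF tau0) ?implybT//; congr (_ `^ _); ring.
rewrite -[X in X <= _]addr0 /M.
set A := tau `^ (1 - p^-1); set B := tau `^ (1 - alpha).
have -> : (G * (K / (1 - alpha)) + 1) * (A * B) * L * S =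
  G * (K * A * L * S * (B / (1 - alpha))) + A * B * L * S by ring.
by rewrite lerD2l !mulr_ge0 ?powR_ge0.
Qed.
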